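(* Let $k$ be a field. The forgetful functor $F_2$ from the category of Poisson Hopf algebras over $k$ to the category of Poisson bialgebras over $k$ has a left adjoint; i.e. there exists a free Poisson Hopf algebra on every Poisson bialgebra.
   Context: All vector spaces, algebras, coalgebras and tensor products are over a fixed field $k$, and all associative algebras are unital. A Poisson algebra is a vector space $P$ that is both an associative commutative unital algebra and a Lie algebra with bracket $[-,-]$ such that $[p, qr] = [p,q]\,r + q\,[p,r]$ for all $p,q,r \in P$. A morphism of Poisson algebras is a linear map that is both a (unital) algebra map and a Lie algebra map. If $P_1, P_2$ are Poisson algebras, then $P_1 \otimes P_2$ is a Poisson algebra with $(p\otimes q)(r \otimes s) = pr \otimes qs$ and $[p\otimes q, r\otimes s] = pr \otimes [q,s] + [p,r]\otimes qs$. The field $k$ is a Poisson algebra with zero bracket. A Poisson bialgebra is a commutative bialgebra $B$ with a Poisson bracket (making it a Poisson algebra) such that the comultiplication $\Delta_B : B \to B\otimes B$ and the counit $\varepsilon_B : B \to k$ are morphisms of Poisson algebras. A Poisson Hopf algebra is a Poisson bialgebra whose underlying bialgebra is a Hopf algebra (i.e. has an antipode). A morphism of Poisson bialgebras is a map that is both a morphism of Poisson algebras and a morphism of coalgebras. The category of Poisson Hopf algebras is the full subcategory of the category of Poisson bialgebras whose objects are the Poisson Hopf algebras. A free Poisson Hopf algebra on a Poisson bialgebra $B$ is a Poisson Hopf algebra $G(B)$ with a morphism of Poisson bialgebras $i : B \to G(B)$ such that for every Poisson Hopf algebra $H$ and every morphism of Poisson bialgebras $f : B \to H$ there is a unique morphism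 of Poisson Hopf algebras $g : G(B) \to H$ with $g\circ i = f$. *)

(* Defs.v *)
From HB Require Import structures.
From mathcomp Require Import all_boot all_algebra.
From mathcomp Require Import boolp classical_sets ring.

Set Implicit Arguments.
Unset Strict Implicit.
Unset Printing Implicit Defensive.

Import GRing.Theory.
Local Open Scope ring_scope.
Local Open Scope quotient_scope.

Reserved Notation "x ⊗ y" (at level 40, left associativity).

(* Tensor product of vector spaces: formal finite sums of pairs (v, w), modulo
   the smallest congruence that makes (v, w) |-> [:: (v, w)] bilinear. *)

Section Tensor.
Variables (k : fieldType) (V W : lmodType k).
Implicit Types (s t : seq (V * W)).

Inductive tensor_rel : seq (V * W) -> seq (V * W) -> Prop :=
| tr_refl s : tensor_rel s s
| tr_sym s t : tensor_rel s t -> tensor_rel t s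
| tr_trans s t u : tensor_rel s t -> tensor_rel t u -> tensor_rel s u
| tr_cat s s' t t' :
    tensor_rel s s' -> tensor_rel t t' -> tensor_rel (s ++ t) (s' ++ t')
| tr_catC s t : tensor_rel (s ++ t) (t ++ s)
| tr_addl v v' w : tensor_rel [:: (v + v', w)] [:: (v, w); (v', w)]
| tr_addr v w w' : tensor_rel [:: (v, w + w')] [:: (v, w); (v, w')]
| tr_scale (a : k) v w : tensor_rel [:: (a *: v, w)] [:: (v, a *: w)]
| tr_zero w : tensor_rel [:: (0, w)] [::].

Definition tensor_eqb : rel (seq (V * W)) := fun s t => `[< tensor_rel s t >].

Lemma tensor_eqb_refl : reflexive tensor_eqb.
Proof. by move=> s; apply/asboolP; apply: tr_refl. Qed.

Lemma tensor_eqb_sym : symmetric tensor_eqb.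
Proof. by move=> s t; apply: asbool_equiv_eq; split; apply: tr_sym. Qed.

Lemma tensor_eqb_trans : transitive tensor_eqb.
Proof.
move=> t s u /asboolP st /asboolP tu; apply/asboolP; exact: tr_trans st tu.
Qed.

Canonical tensor_equiv :=
  EquivRel tensor_eqb tensor_eqb_refl tensor_eqb_sym tensor_eqb_trans.

Definition tensor : Type := {eq_quot tensor_eqb}.
HB.instance Definition _ := Choice.on tensor.

Definition tclass s : tensor := \pi_{eq_quot tensor_eqb} s.
Definition trepr (x : tensor) : seq (V * W) := repr (x : {eq_quot tensor_eqb}).

Lemma tclassP s t : tensor_rel s t <-> tclass s = tclass t.
Proof.
split=> [st|/eqmodP/asboolP //].
by apply/eqmodP/asboolP.
Qed.

Lemma treprK x : tclass (trepr x) = x.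
Proof. exact: reprK. Qed.

Lemma tensor_repr s : tensor_rel (trepr (tclass s)) s.
Proof. by apply/tclassP; rewrite treprK. Qed.

Lemma tclassW (P : tensor -> Prop) :
  (forall s, P (tclass s)) -> forall x, P x.
Proof. by move=> PP x; rewrite -[x]treprK. Qed.

Definition tensor_zero : tensor := tclass [::].
Definition tensor_add (x y : tensor) : tensor := tclass (trepr x ++ trepr y).
Definition tensor_scale (a : k) (x : tensor) : tensor :=
  tclass [seq (a *: p.1, p.2) | p <- trepr x].

Lemma tensor_addE s t :
  tensor_add (tclass s) (tclass t) = tclass (s ++ t).
Proof. by rewrite /tensor_add; apply/tclassP; apply: tr_cat; apply: tensor_repr. Qed.

Lemma tensor_rel_scale (a : k) s t : tensor_rel s t ->
  tensor_rel [seq (a *: p.1, p.2) | p <- s] [seq (a *: p.1, p.2) | p <- t].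
Proof.
elim=> {s t} [s|s t _|s t u _ st _ tu|s s' t t' _ ss _ tt|s t|v v' w|v w w'
  |b v w|w] /=.
- exact: tr_refl.
- exact: tr_sym.
- exact: tr_trans st tu.
- by rewrite !map_cat; apply: tr_cat.
- by rewrite !map_cat; apply: tr_catC.
- by rewrite scalerDr; apply: tr_addl.
- exact: tr_addr.
- by rewrite scalerA mulrC -scalerA; apply: tr_scale.
- by rewrite scaler0; apply: tr_zero.
Qed.

Lemma tensor_scaleE (a : k) s :
  tensor_scale a (tclass s) = tclass [seq (a *: p.1, p.2) | p <- s].
Proof. by apply/tclassP; apply: tensor_rel_scale; apply: tensor_repr. Qed.

Lemma tensor_addA : associative tensor_add.
Proof.
elim/tclassW=> s; elim/tclassW=> t; elim/tclassW=> u.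
rewrite [tensor_add (tclass t) _]tensor_addE.
by rewrite [tensor_add (tclass s) (tclass t)]tensor_addE !tensor_addE catA.
Qed.

Lemma tensor_addC : commutative tensor_add.
Proof.
elim/tclassW=> s; elim/tclassW=> t; rewrite !tensor_addE.
by apply/tclassP; apply: tr_catC.
Qed.

Lemma tensor_add0 : left_id tensor_zero tensor_add.
Proof. by elim/tclassW=> s; rewrite tensor_addE. Qed.

Lemma tensor_addN : left_inverse tensor_zero (tensor_scale (-1)) tensor_add.
Proof.
elim/tclassW=> s0; rewrite tensor_scaleE tensor_addE; apply/tclassP.
elim: s0 => [|[v w] s IHs] /=; first exact: tr_refl.
rewrite -cat1s -[(v, w) :: s]cat1s -cat1s catA.
set n := map _ _ in IHs *.
apply: (tr_trans (t := ([:: (-1 *: v, w)] ++ [:: (v, w)]) ++ (n ++ s))).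
  rewrite -!catA; apply: tr_cat; first exact: tr_refl.
  by rewrite !catA; apply: tr_cat; [exact: tr_catC | exact: tr_refl].
rewrite -[X in tensor_rel _ X]cats0; apply: tr_cat => //.
apply: (tr_trans (t := [:: (0, w)])); last exact: tr_zero.
by rewrite scaleN1r -(addNr v); apply/tr_sym/tr_addl.
Qed.

HB.instance Definition _ :=
  GRing.isZmodule.Build tensor tensor_addA tensor_addC tensor_add0 tensor_addN.

Lemma tclassD s t : tclass s + tclass t = tclass (s ++ t).
Proof. exact: tensor_addE. Qed.

Lemma tensor_scaleA (a b : k) x :
  tensor_scale a (tensor_scale b x) = tensor_scale (a * b) x.
Proof.
elim/tclassW: x => s; rewrite [tensor_scale b _]tensor_scaleE !tensor_scaleE.
rewrite -map_comp; congr (tclass _).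
by apply: eq_map => p /=; rewrite scalerA.
Qed.

Lemma tensor_scale1 : left_id 1 tensor_scale.
Proof.
elim/tclassW=> s; rewrite tensor_scaleE; congr (tclass _).
by rewrite -[RHS]map_id; apply: eq_map => -[v w] /=; rewrite scale1r.
Qed.

Lemma tensor_scaleDr : right_distributive tensor_scale +%R.
Proof.
move=> a; elim/tclassW=> s; elim/tclassW=> t.
by rewrite tclassD !tensor_scaleE tclassD map_cat.
Qed.

Lemma tensor_scaleDl x : {morph tensor_scale^~ x : a b / a + b}.
Proof.
elim/tclassW: x => s0 a b; rewrite !tensor_scaleE tclassD.
apply/tclassP; elim: s0 => [|[v w] s IHs] /=; first exact: tr_refl.
rewrite -cat1s -[X in tensor_rel _ X]cat1s.
set sa := map _ s in IHs *; set sb := map _ s in IHs *.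
set sc := map _ s in IHs *.
apply: (tr_trans (t := ([:: (a *: v, w)] ++ [:: (b *: v, w)]) ++ (sb ++ sc))).
  by apply: tr_cat => //; rewrite scalerDl; apply: tr_addl.
rewrite -!catA; apply: tr_cat; first exact: tr_refl.
rewrite -[_ :: sc]cat1s !catA; apply: tr_cat; last exact: tr_refl.
exact: tr_catC.
Qed.

HB.instance Definition _ := GRing.Zmodule_isLmodule.Build k tensor
  tensor_scaleA tensor_scale1 tensor_scaleDr tensor_scaleDl.

Lemma tclassZ (a : k) s : a *: tclass s = tclass [seq (a *: p.1, p.2) | p <- s].
Proof. exact: tensor_scaleE. Qed.

Definition pure (v : V) (w : W) : tensor := tclass [:: (v, w)].

Lemma pureDl v v' w : pure (v + v') w = pure v w + pure v' w.
Proof.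
by rewrite tclassD; apply/tclassP; apply: tr_addl.
Qed.

Lemma pureDr v w w' : pure v (w + w') = pure v w + pure v w'.
Proof.
by rewrite tclassD; apply/tclassP; apply: tr_addr.
Qed.

Lemma pureZl a v w : pure (a *: v) w = a *: pure v w.
Proof. by rewrite tclassZ. Qed.

Lemma pureZr a v w : pure v (a *: w) = a *: pure v w.
Proof. by rewrite -pureZl; apply/tclassP; apply/tr_sym/tr_scale. Qed.

Lemma pi_tensorE s : tclass s = \sum_(p <- s) pure p.1 p.2.
Proof.
elim: s => [|[v w] s IHs]; first by rewrite big_nil.
by rewrite big_cons -IHs tclassD.
Qed.

Lemma tensor_ind (P : tensor -> Prop) :
  P 0 -> (forall v w, P (pure v w)) -> (forall x y, P x -> P y -> P (x + y)) ->
  forall x, P x.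
Proof.
move=> P0 Pp PD x; rewrite -[x]treprK pi_tensorE.
by elim/big_ind: _ => // p _; apply: Pp.
Qed.

End Tensor.

Arguments tensor {k} (V W)%_type_scope.
Arguments pure {k V W} v w.
Notation "V ⊗ W" := (tensor V W) : type_scope.
Notation "v ⊗ w" := (pure v w) : ring_scope.

Section TensorLift.
Variable k : fieldType.

Definition bilin (V W U : lmodType k) (f : V -> W -> U) : Prop :=
  (forall w, linear (f^~ w)) /\ (forall v, linear (f v)).

(* The linear map out of V ⊗ W induced by f; only meaningful for bilinear f. *)
Definition tlift (V W U : lmodType k) (f : V -> W -> U) (x : V ⊗ W) : U :=
  \sum_(p <- trepr x) f p.1 p.2.

Lemma linear0_ (U V : lmodType k) (f : U -> V) : linear f -> f 0 = 0.
Proof.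
by move=> lf; have := lf (-1) 0 0; rewrite !scaleN1r !addNr.
Qed.

Lemma linearD_ (U V : lmodType k) (f : U -> V) :
  linear f -> {morph f : x y / x + y}.
Proof. by move=> lf x y; have := lf 1 x y; rewrite !scale1r. Qed.

Lemma linearZ_ (U V : lmodType k) (f : U -> V) :
  linear f -> forall a, {morph f : x / a *: x}.
Proof.
by move=> lf a x; have := lf a x 0; rewrite (linear0_ lf) !addr0.
Qed.

Lemma mk_linear (U V : lmodType k) (f : U -> V) :
  {morph f : x y / x + y} -> (forall a, {morph f : x / a *: x}) -> linear f.
Proof. by move=> fD fZ a x y; rewrite fD fZ. Qed.

Lemma pure_bilin (V W : lmodType k) : bilin (@pure k V W).
Proof.
split=> [w a x y|v a x y]; first by rewrite pureDl pureZl.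
by rewrite pureDr pureZr.
Qed.

Section Bilin.
Variables (V W U : lmodType k) (f : V -> W -> U).
Hypothesis bf : bilin f.

Lemma bilin0l w : f 0 w = 0. Proof. exact: linear0_ (bf.1 w). Qed.
Lemma bilin0r v : f v 0 = 0. Proof. exact: linear0_ (bf.2 v). Qed.
Lemma bilinDl v v' w : f (v + v') w = f v w + f v' w.
Proof. exact: linearD_ (bf.1 w) v v'. Qed.
Lemma bilinDr v w w' : f v (w + w') = f v w + f v w'.
Proof. exact: linearD_ (bf.2 v) w w'. Qed.
Lemma bilinZl a v w : f (a *: v) w = a *: f v w.
Proof. exact: linearZ_ (bf.1 w) a v. Qed.
Lemma bilinZr a v w : f v (a *: w) = a *: f v w.
Proof. exact: linearZ_ (bf.2 v) a w. Qed.

Lemma tlift_pi s : tlift f (tclass s) = \sum_(p <- s) f p.1 p.2.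
Proof.
rewrite /tlift; move: (trepr _) (tensor_repr s) => r.
elim=> {r s} [s|s t _ ->|s t u _ -> _ ->|s s' t t' _ e _ e'|s t|v v' w|v w w'
  |b v w|w] //=.
- by rewrite !big_cat /= e e'.
- by rewrite !big_cat /= addrC.
- by rewrite !big_cons !big_nil /= !addr0 bilinDl.
- by rewrite !big_cons !big_nil /= !addr0 bilinDr.
- by rewrite !big_cons !big_nil /= bilinZl bilinZr.
- by rewrite !big_cons !big_nil /= bilin0l addr0.
Qed.

Lemma tlift_pure v w : tlift f (v ⊗ w) = f v w.
Proof. by rewrite tlift_pi big_seq1. Qed.

Lemma tlift_linear : linear (tlift f).
Proof.
apply: mk_linear => [x y|a x].
  elim/tclassW: x => s; elim/tclassW: y => t; rewrite tclassD !tlift_pi.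
  by rewrite big_cat.
elim/tclassW: x => s; rewrite tclassZ !tlift_pi.
by rewrite big_map /= scaler_sumr; apply: eq_bigr => p _; rewrite bilinZl.
Qed.

End Bilin.

Lemma tensor_linear_ext (V W U : lmodType k) (f g : V ⊗ W -> U) :
  linear f -> linear g -> (forall v w, f (v ⊗ w) = g (v ⊗ w)) -> f =1 g.
Proof.
move=> lf lg fg x; elim/tensor_ind: x => [|v w|x y ex ey].
- by rewrite !linear0_.
- exact: fg.
- by rewrite (linearD_ lf) (linearD_ lg) ex ey.
Qed.

Definition tmap (V V' W W' : lmodType k) (f : V -> V') (g : W -> W') :
  V ⊗ W -> V' ⊗ W' := tlift (fun v w => f v ⊗ g w).

Section Tmap.
Variables (V V' W W' : lmodType k).
Variables (f : {linear V -> V'}) (g : {linear W -> W'}).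

Lemma tmap_bilin : bilin (fun v w => f v ⊗ g w).
Proof.
split=> [w a x y|v a x y]; first by rewrite linearP pureDl pureZl.
by rewrite linearP pureDr pureZr.
Qed.

Lemma tmap_pure v w : tmap f g (v ⊗ w) = f v ⊗ g w.
Proof. exact: (tlift_pure tmap_bilin). Qed.

HB.instance Definition _ :=
  GRing.isLinear.Build k (tensor V W) (tensor V' W') *:%R (tmap f g)
    (tlift_linear tmap_bilin).
End Tmap.

Definition tassoc (U V W : lmodType k) : (U ⊗ V) ⊗ W -> U ⊗ (V ⊗ W) :=
  tlift (fun x w => tlift (fun u v => u ⊗ (v ⊗ w)) x).

Lemma tassoc_bilin_in (U V W : lmodType k) (w : W) :
  bilin (fun (u : U) (v : V) => u ⊗ (v ⊗ w)).
Proof.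
split=> [v a x y|u a x y]; first by rewrite pureDl pureZl.
by rewrite pureDl pureZl pureDr pureZr.
Qed.

Lemma tassoc_bilin (U V W : lmodType k) :
  bilin (fun (x : U ⊗ V) (w : W) => tlift (fun u v => u ⊗ (v ⊗ w)) x).
Proof.
split=> [w|x a w w']; first exact: tlift_linear (tassoc_bilin_in _ _ _).
elim/tensor_ind: x => [|u v|x y ex ey].
- by rewrite !(linear0_ (tlift_linear (tassoc_bilin_in _ _ _))) scaler0 addr0.
- rewrite !(tlift_pure (tassoc_bilin_in _ _ _)).
  by rewrite !(pureDr, pureZr).
- rewrite !(linearD_ (tlift_linear (tassoc_bilin_in _ _ _))) ex ey.
  by rewrite scalerDr addrACA.
Qed.

Lemma tassoc_linear (U V W : lmodType k) : linear (@tassoc U V W).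
Proof. exact: tlift_linear (@tassoc_bilin U V W). Qed.

Lemma tassoc_pure (U V W : lmodType k) (u : U) (v : V) (w : W) :
  tassoc ((u ⊗ v) ⊗ w) = u ⊗ (v ⊗ w).
Proof.
rewrite /tassoc (tlift_pure (@tassoc_bilin U V W)).
by rewrite (tlift_pure (tassoc_bilin_in U V w)).
Qed.

(* The bilinear operation with (v ⊗ w, v' ⊗ w') |-> f v v' ⊗ g w w'. *)
Definition tprod (V W : lmodType k) (f : V -> V -> V) (g : W -> W -> W)
    (x y : V ⊗ W) : V ⊗ W :=
  tlift (fun v w => tlift (fun v' w' => f v v' ⊗ g w w') y) x.

Section Tprod.
Variables (V W : lmodType k) (f : V -> V -> V) (g : W -> W -> W).
Hypotheses (bf : bilin f) (bg : bilin g).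

Lemma tprod_bilin1 v w : bilin (fun v' w' => f v v' ⊗ g w w').
Proof.
split=> [w' a x y|v' a x y].
  by rewrite (bilinDr bf) (bilinZr bf) pureDl pureZl.
by rewrite (bilinDr bg) (bilinZr bg) pureDr pureZr.
Qed.

Lemma tprod_bilin2 y : bilin (fun v w => tlift (fun v' w' => f v v' ⊗ g w w') y).
Proof.
split=> [w a v1 v2|v a w1 w2].
  elim/tensor_ind: y => [|v' w'|x y ex ey].
  - by rewrite !(linear0_ (tlift_linear (tprod_bilin1 _ _))) scaler0 addr0.
  - rewrite !(tlift_pure (tprod_bilin1 _ _)).
    by rewrite (bilinDl bf) (bilinZl bf) pureDl pureZl.
  - rewrite !(linearD_ (tlift_linear (tprod_bilin1 _ _))) ex ey.
    by rewrite scalerDr addrACA.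
elim/tensor_ind: y => [|v' w'|x y ex ey].
- by rewrite !(linear0_ (tlift_linear (tprod_bilin1 _ _))) scaler0 addr0.
- rewrite !(tlift_pure (tprod_bilin1 _ _)).
  by rewrite (bilinDl bg) (bilinZl bg) pureDr pureZr.
- rewrite !(linearD_ (tlift_linear (tprod_bilin1 _ _))) ex ey.
  by rewrite scalerDr addrACA.
Qed.

Lemma tprod_bilin : bilin (tprod f g).
Proof.
split=> [y|x]; first exact: (tlift_linear (tprod_bilin2 y)).
move=> a y1 y2; elim/tensor_ind: x => [|v w|x1 x2 e1 e2].
- by rewrite /tprod !(linear0_ (tlift_linear (tprod_bilin2 _))) scaler0 addr0.
- rewrite /tprod !(tlift_pure (tprod_bilin2 _)).
  exact: (tlift_linear (tprod_bilin1 _ _)).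
- rewrite /tprod !(linearD_ (tlift_linear (tprod_bilin2 _))).
  by rewrite [LHS](congr2 _ e1 e2) scalerDr addrACA.
Qed.

Lemma tprod_pure v w v' w' :
  tprod f g (v ⊗ w) (v' ⊗ w') = f v v' ⊗ g w w'.
Proof.
by rewrite /tprod (tlift_pure (tprod_bilin2 _)) (tlift_pure (tprod_bilin1 _ _)).
Qed.

End Tprod.

End TensorLift.

Section TensorNonzero.
Variable k : fieldType.

Lemma exists_functional (V : lmodType k) (v : V) : v != 0 ->
  exists f : V -> k^o, linear f /\ f v = 1.
Proof.
move=> vN0.
pose P (A : set V) :=
  (forall (a : k) x y, A x -> A y -> A (a *: x + y)) /\ ~ A v.
have [F FP Ft|A [[linA AvN] maxA]] := @Zorn_bigcup V P.
  split=> [a x y [X FX Xx] [Y FY Yy]|[X FX Xv]]; last by case: (FP _ FX).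
  have [XY|YX] := Ft X Y FX FY.
    by exists Y => //; apply: (FP _ FY).1 => //; apply: XY.
  by exists X => //; apply: (FP _ FX).1 => //; apply: YX.
have A0 : A 0.
  apply: contrapT => A0N; have Ae x : ~ A x.
    by move=> Ax; apply: A0N; have := linA (-1) x x Ax Ax; rewrite scaleN1r addNr.
  apply: (maxA [set 0]%classic).
    by split=> [x /Ae //|/(_ 0 erefl)].
  split=> [a x y /= -> ->|/= v0]; first by rewrite scaler0 addr0.
  by rewrite v0 eqxx in vN0.
have AD x y : A x -> A y -> A (x + y).
  by move=> Ax Ay; rewrite -[x]scale1r; apply: linA.
have AZ a x : A x -> A (a *: x).
  by move=> Ax; rewrite -[X in A X]addr0; apply: linA.
have decomp x : exists a : k, A (x - a *: v).
  apply: contrapT => nex; apply: (maxA [set y | exists2 m, A m & exists b : k, y = m + b *: x]%classic).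
    split=> [y Ay|sub]; first by exists y => //; exists 0; rewrite scale0r addr0.
    apply: nex; exists 0; rewrite scale0r subr0; apply: sub.
    by exists 0 => //; exists 1; rewrite scale1r add0r.
  split=> [a y z [m Am [b ->]] [n An [c ->]]|[m Am [b vE]]].
    exists (a *: m + n); first exact: linA.
    by exists (a * b + c); rewrite scalerDr scalerDl scalerA addrACA.
  have [b0|bN0] := eqVneq b 0.
    by apply: AvN; rewrite vE b0 scale0r addr0.
  apply: nex; exists b^-1.
  rewrite vE scalerDr scalerA mulVf // scale1r opprD addrCA subrr addr0.
  by rewrite -scaleNr; apply: AZ.
have uniqA a b x : A (x - a *: v) -> A (x - b *: v) -> a = b.
  move=> Aa Ab; apply/eqP; apply: contrapT => /negP ab; apply: AvN.
  rewrite -[v](@scalerK k V (b - a)) ?subr_eq0 1?eq_sym //; apply: AZ.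
  rewrite scalerBl.
  have -> : b *: v - a *: v = -1 *: (x - b *: v) + (x - a *: v).
    by rewrite scaleN1r opprB addrA subrK.
  exact: linA.
pose f x : k^o := projT1 (cid (decomp x)).
have fP x : A (x - f x *: v) by rewrite /f; case: cid.
exists f; split=> [a x y|].
  apply: (uniqA _ _ (a *: x + y)); first exact: fP.
  have -> : a *: x + y - (a *: f x + f y : k^o) *: v
      = a *: (x - f x *: v) + (y - f y *: v).
    by rewrite scalerBr scalerDl scalerA opprD addrACA.
  by apply: linA; apply: fP.
by apply: (uniqA _ _ v); [exact: fP | rewrite scale1r subrr].
Qed.

Lemma pure_neq0 (V W : lmodType k) (v : V) (w : W) :
  v != 0 -> w != 0 -> v ⊗ w != 0.
Proof.
move=> /exists_functional[f [lf fv]] /exists_functional[g [lg gw]].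
have bfg : bilin (fun v w => f v *: g w : k^o).
  split=> [y a x1 x2|x a y1 y2]; first by rewrite lf scalerDl scalerA.
  by rewrite lg scalerDr !scalerA mulrC.
apply/eqP => vw0; have /eqP[] := oner_neq0 k.
rewrite -[LHS]mulr1 -{1}fv -gw -[LHS]/(f v *: g w : k^o).
by rewrite -(tlift_pure bfg) vw0 (linear0_ (tlift_linear bfg)).
Qed.

End TensorNonzero.

HB.mixin Record isLieAlgebra (k : fieldType) L of GRing.Lmodule k L := {
  bracket : L -> L -> L;
  bracket_bilin : bilin bracket;
  bracketxx : forall x, bracket x x = 0;
  bracket_jacobi : forall x y z,
    bracket x (bracket y z) + bracket y (bracket z x)
      + bracket z (bracket x y) = 0
}.

#[short(type="lieAlgType")]
HB.structure Definition LieAlgebra (k : fieldType) :=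
  {L of GRing.Lmodule k L & isLieAlgebra k L}.

Notation "⟦ x , y ⟧" := (bracket x y)
  (at level 0, format "⟦ x ,  y ⟧") : ring_scope.

(* comAlgType excludes the zero algebra, which carries no bialgebra structure:
   a counit forces 1 != 0. *)
HB.mixin Record isPoissonAlgebra (k : fieldType) P
    of GRing.ComAlgebra k P & LieAlgebra k P := {
  bracket_leibniz : forall p q r : P,
    ⟦ p, q * r ⟧ = ⟦ p, q ⟧ * r + q * ⟦ p, r ⟧
}.

#[short(type="poissonAlgType")]
HB.structure Definition PoissonAlgebra (k : fieldType) :=
  {P of GRing.ComAlgebra k P & LieAlgebra k P & isPoissonAlgebra k P}.

Section PoissonTheory.
Variable k : fieldType.

Lemma mul_bilin (A : comAlgType k) : bilin (@GRing.mul A).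
Proof.
split=> [y a x1 x2|x a y1 y2]; first by rewrite mulrDl scalerAl.
by rewrite mulrDr scalerAr.
Qed.

Lemma bracketC (L : lieAlgType k) (x y : L) : ⟦ x, y ⟧ = - ⟦ y, x ⟧.
Proof.
apply/eqP; rewrite -addr_eq0; apply/eqP; have := bracketxx (x + y).
rewrite (bilinDl bracket_bilin) !(bilinDr bracket_bilin) !bracketxx.
by rewrite add0r addr0.
Qed.

End PoissonTheory.

Section TensorComAlgebra.
Variables (k : fieldType) (A B : comAlgType k).

Definition tmul : A ⊗ B -> A ⊗ B -> A ⊗ B := tprod *%R *%R.

Lemma tmul_bilin : bilin tmul.
Proof. exact: (tprod_bilin (mul_bilin A) (mul_bilin B)). Qed.

Lemma tmul_pure a b a' b' : tmul (a ⊗ b) (a' ⊗ b') = (a * a') ⊗ (b * b').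
Proof. exact: (tprod_pure (mul_bilin A) (mul_bilin B)). Qed.

Let simp := (bilin0l tmul_bilin, bilin0r tmul_bilin, bilinDl tmul_bilin,
  bilinDr tmul_bilin, tmul_pure).

Lemma tmulA : associative tmul.
Proof.
move=> x y z; elim/tensor_ind: x => [|a b|x x' ex ex']; rewrite ?simp //.
  elim/tensor_ind: y => [|a' b'|y y' ey ey']; rewrite ?simp //.
    elim/tensor_ind: z => [|a'' b''|z z' ez ez']; rewrite ?simp //.
      by rewrite !mulrA.
    by rewrite ez ez'.
  by rewrite ey ey'.
by rewrite ex ex'.
Qed.

Lemma tmulC : commutative tmul.
Proof.
move=> x y; elim/tensor_ind: x => [|a b|x x' ex ex']; rewrite ?simp //.
  elim/tensor_ind: y => [|a' b'|y y' ey ey']; rewrite ?simp //.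
    by rewrite mulrC [b * _]mulrC.
  by rewrite ey ey'.
by rewrite ex ex'.
Qed.

Lemma tmul1 : left_id (1 ⊗ 1) tmul.
Proof.
move=> x; elim/tensor_ind: x => [|a b|x x' ex ex']; rewrite ?simp //.
  by rewrite !mul1r.
by rewrite ex ex'.
Qed.

Lemma tmulDl : left_distributive tmul +%R.
Proof. move=> x y z; exact: (bilinDl tmul_bilin). Qed.

Lemma tone_neq0 : (1 ⊗ 1 : A ⊗ B) != 0.
Proof. by apply: pure_neq0; apply: oner_neq0. Qed.

HB.instance Definition _ := GRing.Zmodule_isComNzRing.Build (tensor A B)
  tmulA tmulC tmul1 tmulDl tone_neq0.

Lemma tscaleAl (a : k) (x y : A ⊗ B) : a *: (x * y) = (a *: x) * y.
Proof. exact/esym/(bilinZl tmul_bilin). Qed.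

HB.instance Definition _ :=
  GRing.Lmodule_isLalgebra.Build k (tensor A B) tscaleAl.
HB.instance Definition _ :=
  GRing.Lalgebra_isComAlgebra.Build k (tensor A B).

Lemma mul_pure (a a' : A) (b b' : B) :
  (a ⊗ b) * (a' ⊗ b') = (a * a') ⊗ (b * b').
Proof. exact: tmul_pure. Qed.

Lemma one_tensor : 1 = 1 ⊗ 1 :> A ⊗ B.
Proof. by []. Qed.

End TensorComAlgebra.

Section TensorPoisson.
Variables (k : fieldType) (P Q : poissonAlgType k).

Definition tbracket (x y : P ⊗ Q) : P ⊗ Q :=
  tprod *%R bracket x y + tprod bracket *%R x y.

Let bP := @bracket_bilin k P.
Let bQ := @bracket_bilin k Q.
Let mP := mul_bilin P.
Let mQ := mul_bilin Q.

Lemma tbracket_pure p q r s :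
  tbracket (p ⊗ q) (r ⊗ s) = (p * r) ⊗ ⟦ q, s ⟧ + ⟦ p, r ⟧ ⊗ (q * s).
Proof. by rewrite /tbracket (tprod_pure mP bQ) (tprod_pure bP mQ). Qed.

Lemma tbracket_bilin : bilin tbracket.
Proof.
have [b1l b1r] := tprod_bilin mP bQ; have [b2l b2r] := tprod_bilin bP mQ.
split=> [y a x x'|x a y y']; rewrite /tbracket scalerDr addrACA; congr (_ + _).
- exact: b1l.
- exact: b2l.
- exact: b1r.
- exact: b2r.
Qed.

Let b0l := bilin0l tbracket_bilin.
Let b0r := bilin0r tbracket_bilin.
Let bDl := bilinDl tbracket_bilin.
Let bDr := bilinDr tbracket_bilin.

Lemma tbracketC x y : tbracket x y = - tbracket y x.
Proof.
elim/tensor_ind: x => [|p q|x x' ex ex'].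
- by rewrite b0l b0r oppr0.
- elim/tensor_ind: y => [|r s|y y' ey ey'].
  + by rewrite b0l b0r oppr0.
  + rewrite !tbracket_pure [r * p]mulrC [s * q]mulrC.
    rewrite [in RHS]bracketC [⟦ r, p ⟧]bracketC.
    by rewrite -!scaleN1r !(pureZl, pureZr) -scalerDr scalerA mulrNN mulr1 scale1r.
  + by rewrite bDl bDr ey ey' [in RHS]opprD.
- by rewrite bDl bDr ex ex' [in RHS]opprD.
Qed.

Lemma tbracketxx x : tbracket x x = 0.
Proof.
elim/tensor_ind: x => [|p q|x y ex ey].
- by rewrite b0l.
- rewrite tbracket_pure !bracketxx.
  by rewrite (bilin0r (pure_bilin _ _)) (bilin0l (pure_bilin _ _)) addr0.
- by rewrite bDl !bDr ex ey [tbracket y x]tbracketC add0r addr0 subrr.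
Qed.

Lemma tbracket_leibniz x y z :
  tbracket x (y * z) = tbracket x y * z + y * tbracket x z.
Proof.
elim/tensor_ind: x => [|p q|x x' ex ex'].
- by rewrite !b0l mul0r mulr0 addr0.
- elim/tensor_ind: y => [|r s|y y' ey ey'].
  + by rewrite !(mul0r, b0r) addr0.
  + elim/tensor_ind: z => [|t u|z z' ez ez'].
    * by rewrite !(mulr0, b0r) addr0.
    * rewrite mul_pure !tbracket_pure !bracket_leibniz mulrDl mulrDr !mul_pure.
      rewrite !(pureDl, pureDr) addrACA.
      by congr (_ ⊗ _ + _ ⊗ _ + (_ ⊗ _ + _ ⊗ _)); ring.
    * by rewrite mulrDr !bDr ez ez'; ring.
  + by rewrite mulrDl !bDr ey ey'; ring.
- by rewrite !bDl ex ex'; ring.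
Qed.

Let pureNl (a : P) (c : Q) : (- a) ⊗ c = - (a ⊗ c).
Proof. by rewrite -scaleN1r pureZl scaleN1r. Qed.

Let pureNr (a : P) (c : Q) : a ⊗ (- c) = - (a ⊗ c).
Proof. by rewrite -scaleN1r pureZr scaleN1r. Qed.

Let tbracket2 p q r s t u :
  tbracket (p ⊗ q) (tbracket (r ⊗ s) (t ⊗ u)) =
    (p * r * t) ⊗ ⟦ q, ⟦ s, u ⟧ ⟧ + ⟦ p, ⟦ r, t ⟧ ⟧ ⊗ (q * s * u)
    + ((⟦ p, r ⟧ * t) ⊗ (⟦ s, u ⟧ * q) - (⟦ t, p ⟧ * r) ⊗ (⟦ s, u ⟧ * q))
    + ((⟦ r, t ⟧ * p) ⊗ (⟦ q, s ⟧ * u) - (⟦ r, t ⟧ * p) ⊗ (⟦ u, q ⟧ * s)).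
Proof.
rewrite [tbracket (r ⊗ s) _]tbracket_pure bDr !tbracket_pure.
have -> : ⟦ p, r * t ⟧ = ⟦ p, r ⟧ * t - ⟦ t, p ⟧ * r.
  by rewrite bracket_leibniz [⟦ p, t ⟧]bracketC; ring.
have -> : ⟦ q, s * u ⟧ = ⟦ q, s ⟧ * u - ⟦ u, q ⟧ * s.
  by rewrite bracket_leibniz [⟦ q, u ⟧]bracketC; ring.
rewrite !mulrA [p * ⟦ r, t ⟧]mulrC [q * ⟦ s, u ⟧]mulrC.
by rewrite pureDl pureDr pureNl pureNr; ring.
Qed.

Lemma jacobi_pure (b : P ⊗ Q -> P ⊗ Q -> P ⊗ Q) : bilin b ->
  (forall p q r s t u,
    b (p ⊗ q) (b (r ⊗ s) (t ⊗ u)) + b (r ⊗ s) (b (t ⊗ u) (p ⊗ q))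
      + b (t ⊗ u) (b (p ⊗ q) (r ⊗ s)) = 0) ->
  forall x y z, b x (b y z) + b y (b z x) + b z (b x y) = 0.
Proof.
move=> bb bJ x y z.
have simp := (bilin0l bb, bilin0r bb, bilinDl bb, bilinDr bb).
elim/tensor_ind: x => [|p q|x x' ex ex'].
- by rewrite !simp !addr0.
- elim/tensor_ind: y => [|r s|y y' ey ey'].
  + by rewrite !simp !addr0.
  + elim/tensor_ind: z => [|t u|z z' ez ez'].
    * by rewrite !simp !addr0.
    * exact: bJ.
    * rewrite !simp -[RHS](addr0 0) -[X in _ = X + _]ez.
      by rewrite -[X in _ = _ + X]ez'; ring.
  + rewrite !simp -[RHS](addr0 0) -[X in _ = X + _]ey.
    by rewrite -[X in _ = _ + X]ey'; ring.
- rewrite !simp -[RHS](addr0 0) -[X in _ = X + _]ex.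
  by rewrite -[X in _ = _ + X]ex'; ring.
Qed.

Lemma tbracket_jacobi x y z :
  tbracket x (tbracket y z) + tbracket y (tbracket z x)
    + tbracket z (tbracket x y) = 0.
Proof.
apply: (jacobi_pure tbracket_bilin) => p q r s t u.
rewrite !tbracket2.
have -> : r * t * p = p * r * t by ring.
have -> : t * p * r = p * r * t by ring.
have -> : s * u * q = q * s * u by ring.
have -> : u * q * s = q * s * u by ring.
have jQ : (p * r * t) ⊗ ⟦ q, ⟦ s, u ⟧ ⟧
    + (p * r * t) ⊗ ⟦ s, ⟦ u, q ⟧ ⟧
    + (p * r * t) ⊗ ⟦ u, ⟦ q, s ⟧ ⟧ = 0.
  by rewrite -!pureDr bracket_jacobi (bilin0r (pure_bilin _ _)).
have jP : ⟦ p, ⟦ r, t ⟧ ⟧ ⊗ (q * s * u)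
    + ⟦ r, ⟦ t, p ⟧ ⟧ ⊗ (q * s * u)
    + ⟦ t, ⟦ p, r ⟧ ⟧ ⊗ (q * s * u) = 0.
  by rewrite -!pureDl bracket_jacobi (bilin0l (pure_bilin _ _)).
by rewrite -[RHS](addr0 0) -[X in _ = X + _]jQ -[X in _ = _ + X]jP; ring.
Qed.

HB.instance Definition _ := isLieAlgebra.Build k (tensor P Q)
  tbracket_bilin tbracketxx tbracket_jacobi.
HB.instance Definition _ := isPoissonAlgebra.Build k (tensor P Q)
  tbracket_leibniz.

End TensorPoisson.

Section RegularPoisson.
Variable k : fieldType.

Definition zero_bracket (x y : k^o) : k^o := 0.

Lemma zero_bracket_bilin : bilin zero_bracket.
Proof. by split=> x a y z; rewrite /zero_bracket scaler0 addr0. Qed.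

Lemma zero_bracket_jacobi (x y z : k^o) :
  zero_bracket x (zero_bracket y z) + zero_bracket y (zero_bracket z x)
    + zero_bracket z (zero_bracket x y) = 0.
Proof. by rewrite /zero_bracket !addr0. Qed.

HB.instance Definition _ := isLieAlgebra.Build k k^o
  zero_bracket_bilin (fun=> erefl) zero_bracket_jacobi.

Lemma zero_bracket_leibniz (p q r : k^o) :
  ⟦ p, q * r ⟧ = ⟦ p, q ⟧ * r + q * ⟦ p, r ⟧.
Proof. by rewrite /bracket /= /zero_bracket mul0r mulr0 addr0. Qed.

HB.instance Definition _ :=
  isPoissonAlgebra.Build k k^o zero_bracket_leibniz.

End RegularPoisson.

Definition poisson_morphism (k : fieldType) (P Q : poissonAlgType k)
    (f : P -> Q) : Prop :=
  [/\ linear f, monoid_morphism f & {morph f : x y / ⟦ x, y ⟧}].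

HB.mixin Record isCoalgebra (k : fieldType) C of GRing.Lmodule k C := {
  comul : {linear C -> (C ⊗ C)%type};
  counit : {linear C -> k^o};
  comulA : forall c : C,
    tassoc (tmap comul idfun (comul c)) = tmap idfun comul (comul c);
  counitl : forall c : C, tmap counit idfun (comul c) = (1 : k^o) ⊗ c;
  counitr : forall c : C, tmap idfun counit (comul c) = c ⊗ (1 : k^o)
}.

#[short(type="coalgType")]
HB.structure Definition Coalgebra (k : fieldType) :=
  {C of GRing.Lmodule k C & isCoalgebra k C}.

Arguments comul {k s}.
Arguments counit {k s}.

Definition coalgebra_morphism (k : fieldType) (C D : coalgType k)
    (f : C -> D) : Prop :=
  [/\ linear f,
      forall c, comul (f c) = tmap f f (comul c) &
      forall c, counit (f c) = counit c].

HB.mixin Record isPoissonBialgebra (k : fieldType) B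
    of PoissonAlgebra k B & Coalgebra k B := {
  comul_poisson : poisson_morphism (comul : B -> B ⊗ B);
  counit_poisson : poisson_morphism (counit : B -> k^o)
}.

#[short(type="poissonBialgType")]
HB.structure Definition PoissonBialgebra (k : fieldType) :=
  {B of PoissonAlgebra k B & Coalgebra k B & isPoissonBialgebra k B}.

(* S is a convolution inverse of the identity. *)
Definition is_antipode (k : fieldType) (B : poissonBialgType k)
    (S : {linear B -> B}) : Prop :=
  forall x : B,
    tlift *%R (tmap S idfun (comul x)) = (counit x : k) *: (1 : B) /\
    tlift *%R (tmap idfun S (comul x)) = (counit x : k) *: (1 : B).

HB.mixin Record hasAntipode (k : fieldType) H of PoissonBialgebra k H := {
  antipode_exists : exists S : {linear H -> H}, is_antipode S
}.

#[short(type="poissonHopfType")]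
HB.structure Definition PoissonHopf (k : fieldType) :=
  {H of PoissonBialgebra k H & hasAntipode k H}.

Definition poisson_bialg_morphism (k : fieldType) (B C : poissonBialgType k)
    (f : B -> C) : Prop :=
  poisson_morphism f /\ coalgebra_morphism f.

(* Morphisms of Poisson Hopf algebras are the morphisms of the underlying
   Poisson bialgebras. *)
Definition is_free_poisson_hopf (k : fieldType) (B : poissonBialgType k)
    (G : poissonHopfType k) (i : B -> G) : Prop :=
  poisson_bialg_morphism i /\
  forall (H : poissonHopfType k) (f : B -> H), poisson_bialg_morphism f ->
    exists! g : G -> H, poisson_bialg_morphism g /\ g \o i = f.

Record category := Category {
  obj :> Type;
  hom : obj -> obj -> Type;
  idm : forall X, hom X X;
  comp : forall X Y Z, hom Y Z -> hom X Y -> hom X Z;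
  comp1m : forall X Y (f : hom X Y), comp (idm Y) f = f;
  compm1 : forall X Y (f : hom X Y), comp f (idm X) = f;
  compmA : forall X Y Z T (h : hom Z T) (g : hom Y Z) (f : hom X Y),
    comp h (comp g f) = comp (comp h g) f
}.

Arguments hom {c} X Y.
Arguments idm {c} X.
Arguments comp {c X Y Z} g f.

Record functor (C D : category) := Functor {
  fobj :> C -> D;
  fmap : forall X Y : C, hom X Y -> hom (fobj X) (fobj Y);
  fmap1 : forall X, fmap (idm X) = idm (fobj X);
  fmapM : forall X Y Z (g : hom Y Z) (f : hom X Y),
    fmap (comp g f) = comp (fmap g) (fmap f)
}.

Arguments fmap {C D} _ {X Y} _.

Definition left_adjoint_of (C D : category) (L : functor D C)
    (F : functor C D) : Prop :=
  exists phi : forall (X : D) (Y : C), hom (L X) Y -> hom X (F Y),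
    [/\ forall X Y, bijective (phi X Y),
        forall X X' Y (u : hom X' X) (h : hom (L X) Y),
          phi X' Y (comp h (fmap L u)) = comp (phi X Y h) u &
        forall X Y Y' (v : hom Y Y') (h : hom (L X) Y),
          phi X Y' (comp v h) = comp (fmap F v) (phi X Y h)].

(* The full subcategory of C on the objects J t, t : T, and its inclusion. *)
Definition full_subcategory (C : category) (T : Type) (J : T -> C) : category :=
  @Category T (fun X Y => hom (J X) (J Y)) (fun X => idm (J X))
    (fun X Y Z => @comp C (J X) (J Y) (J Z))
    (fun X Y => @comp1m C (J X) (J Y)) (fun X Y => @compm1 C (J X) (J Y))
    (fun X Y Z U => @compmA C (J X) (J Y) (J Z) (J U)).

Definition full_inclusion (C : category) (T : Type) (J : T -> C) :
    functor (full_subcategory J) C :=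
  @Functor (full_subcategory J) C J (fun X Y f => f)
    (fun=> erefl) (fun X Y Z g f => erefl).

Section PoissonCategories.
Variable k : fieldType.

Definition poisson_bialg_hom (B C : poissonBialgType k) : Type :=
  {f : B -> C | poisson_bialg_morphism f}.

Lemma poisson_bialg_id (B : poissonBialgType k) :
  poisson_bialg_morphism (@id B).
Proof.
split; first by split.
split=> // c; rewrite -[LHS]/(comul c).
apply: (@tensor_linear_ext _ _ _ _ id) => [//||v w].
  exact: (linearP (tmap (@idfun B) (@idfun B))).
by rewrite (tmap_pure (@idfun B) (@idfun B)).
Qed.

Lemma poisson_bialg_comp (B C D : poissonBialgType k)
    (g : C -> D) (f : B -> C) :
  poisson_bialg_morphism g -> poisson_bialg_morphism f ->
  poisson_bialg_morphism (g \o f).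
Proof.
move=> [[lg [g1 gM] gL] [_ gD ge]] [[lf [f1 fM] fL] [_ fD fe]].
have lgf : linear (g \o f) by move=> a x y /=; rewrite lf lg.
pose g' : {linear C -> D} := HB.pack g (GRing.isLinear.Build k C D *:%R g lg).
pose f' : {linear B -> C} := HB.pack f (GRing.isLinear.Build k B C *:%R f lf).
pose h' : {linear B -> D} :=
  HB.pack (g \o f) (GRing.isLinear.Build k B D *:%R (g \o f) lgf).
split.
  split=> //; last by move=> x y /=; rewrite fL gL.
  by split=> [|x y] /=; rewrite ?f1 ?fM.
split=> // c /=; last by rewrite ge fe.
rewrite gD fD.
apply: (@tensor_linear_ext _ _ _ _ (tmap g' g' \o tmap f' f') (tmap h' h')).
- by move=> a x y; rewrite linearP.
- by move=> a x y; rewrite linearP.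
- move=> v w; rewrite -[LHS]/(tmap g' g' (tmap f' f' (v ⊗ w))).
  by rewrite (tmap_pure f' f') (tmap_pure g' g') (tmap_pure h' h').
Qed.

Definition poisson_bialg_idm (B : poissonBialgType k) : poisson_bialg_hom B B :=
  exist _ _ (poisson_bialg_id B).

Definition poisson_bialg_compm (B C D : poissonBialgType k)
    (g : poisson_bialg_hom C D) (f : poisson_bialg_hom B C) :
    poisson_bialg_hom B D :=
  exist _ _ (poisson_bialg_comp (proj2_sig g) (proj2_sig f)).

Lemma poisson_bialg_hom_eq (B C : poissonBialgType k)
    (f g : poisson_bialg_hom B C) : proj1_sig f = proj1_sig g -> f = g.
Proof. by case: f g => [f pf] [g pg] /= e; apply: eq_exist. Qed.

Lemma poisson_bialg_comp1m B C (f : poisson_bialg_hom B C) :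
  poisson_bialg_compm (poisson_bialg_idm C) f = f.
Proof. exact: poisson_bialg_hom_eq. Qed.

Lemma poisson_bialg_compm1 B C (f : poisson_bialg_hom B C) :
  poisson_bialg_compm f (poisson_bialg_idm B) = f.
Proof. exact: poisson_bialg_hom_eq. Qed.

Lemma poisson_bialg_compmA B C D E (h : poisson_bialg_hom D E)
    (g : poisson_bialg_hom C D) (f : poisson_bialg_hom B C) :
  poisson_bialg_compm h (poisson_bialg_compm g f) =
  poisson_bialg_compm (poisson_bialg_compm h g) f.
Proof. exact: poisson_bialg_hom_eq. Qed.

Definition poissonBialg_cat : category :=
  @Category (poissonBialgType k) poisson_bialg_hom poisson_bialg_idm
    poisson_bialg_compm poisson_bialg_comp1m poisson_bialg_compm1
    poisson_bialg_compmA.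

Definition poissonHopf_cat : category :=
  @full_subcategory poissonBialg_cat (poissonHopfType k)
    (fun H => H : poissonBialgType k).

Definition forget_antipode : functor poissonHopf_cat poissonBialg_cat :=
  @full_inclusion poissonBialg_cat (poissonHopfType k)
    (fun H => H : poissonBialgType k).

End PoissonCategories.

(* Main.v *)
Require Import Defs.
From HB Require Import structures.
From mathcomp Require Import all_boot all_algebra.
From mathcomp Require Import boolp ring.

(* The convolution inverse v of a Poisson algebra map u : B -> A into a
   commutative algebra is automatically multiplicative and satisfies
   v [x, y] = - [v x, v y].  So let G(B) be the Poisson algebra representing
   A |-> {Poisson maps B -> A that are invertible under convolution}, with
   universal map gen and inverse inv_gen.  A Poisson map out of G(B) is
   determined by its restriction along gen, so the comultiplication, the counit,
   their axioms and the factorisation of f : B -> H (whose convolution inverse is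
   S_H o f) all come from this property.  The antipode is the map
   G(B) -> G(B)^- (opposite bracket) that exchanges gen and inv_gen; the elements
   satisfying x_1 S(x_2) = eps(x) form a Poisson subalgebra containing the
   generators. *)

Set Implicit Arguments.
Unset Strict Implicit.
Unset Printing Implicit Defensive.

Import GRing.Theory.
Local Open Scope ring_scope.
Local Open Scope quotient_scope.

(** * Linear maps and tensor products of linear maps *)

Section LinearMaps.
Variable k : fieldType.

Lemma linear_comp (U V W : lmodType k) (g : V -> W) (f : U -> V) :
  linear g -> linear f -> linear (g \o f).
Proof. by move=> lg lf a x y /=; rewrite lf lg. Qed.

Lemma linear_add (U V : lmodType k) (f g : U -> V) :
  linear f -> linear g -> linear (fun x => f x + g x).
Proof. by move=> lf lg a x y; rewrite lf lg scalerDr addrACA. Qed.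

Section Tmap.
Variables (V V' W W' : lmodType k) (f : V -> V') (g : W -> W').
Hypotheses (lf : linear f) (lg : linear g).

Lemma bilin_tmap : bilin (fun v w => f v ⊗ g w).
Proof.
split=> [w a x y|v a x y]; first by rewrite lf pureDl pureZl.
by rewrite lg pureDr pureZr.
Qed.

Lemma tmapE v w : tmap f g (v ⊗ w) = f v ⊗ g w.
Proof. exact: tlift_pure bilin_tmap _ _. Qed.

Lemma linear_tmap : linear (tmap f g).
Proof. exact: tlift_linear bilin_tmap. Qed.

End Tmap.

Lemma linear_id (V : lmodType k) : linear (@idfun V).
Proof. by []. Qed.

Lemma tmap_comp (V V' V'' W W' W'' : lmodType k) (f : V -> V') (f' : V' -> V'')
    (g : W -> W') (g' : W' -> W'') :
  linear f -> linear f' -> linear g -> linear g' ->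
  forall x, tmap f' g' (tmap f g x) = tmap (f' \o f) (g' \o g) x.
Proof.
move=> lf lf' lg lg'.
apply: (@tensor_linear_ext _ _ _ _ (tmap f' g' \o tmap f g)).
- by apply: linear_comp; apply: linear_tmap.
- by apply: linear_tmap; apply: linear_comp.
- by move=> v w /=; rewrite !tmapE //; apply: linear_comp.
Qed.

Lemma tlift_mul_linear (A : comAlgType k) : linear (tlift (@GRing.mul A)).
Proof. exact: tlift_linear (mul_bilin A). Qed.

Lemma tlift_mulE (A : comAlgType k) (x y : A) : tlift *%R (x ⊗ y) = x * y.
Proof. exact: tlift_pure (mul_bilin A) _ _. Qed.

End LinearMaps.

Arguments tlift_mul_linear {k} A.

(** * The convolution algebra of linear maps from a coalgebra to a commutative algebra *)

Section Convolution.
Variables (k : fieldType) (C : coalgType k) (A : comAlgType k).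
Implicit Types f g h : C -> A.

Definition conv f g (x : C) : A := tlift *%R (tmap f g (comul x)).

Definition conv1 (x : C) : A := (counit x : k) *: 1.

Lemma conv1_linear : linear conv1.
Proof. by move=> a x y; rewrite /conv1 linearP scalerDl scalerA. Qed.

Lemma comul_linear : linear (comul : C -> (C ⊗ C)%type).
Proof. by move=> a x y; rewrite linearP. Qed.

Lemma counit_linear : linear (counit : C -> k^o).
Proof. by move=> a x y; rewrite linearP. Qed.

Lemma conv_linear f g : linear f -> linear g -> linear (conv f g).
Proof.
move=> lf lg; change (linear (tlift *%R \o (tmap f g \o comul))).
refine (linear_comp (tlift_mul_linear A) _).
by apply: linear_comp (linear_tmap lf lg) comul_linear.
Qed.

(** Coassociativity turns this into associativity of the product of [A]: the two sides factor
    through the two iterated comultiplications of [x], which the associator identifies. *)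
Lemma convA f g h : linear f -> linear g -> linear h ->
  conv f (conv g h) =1 conv (conv f g) h.
Proof.
move=> lf lg lh x.
have lgh : linear (tlift *%R \o tmap g h).
  by apply: linear_comp (tlift_mul_linear A) _; apply: linear_tmap.
have lfg : linear (tlift *%R \o tmap f g).
  by apply: linear_comp (tlift_mul_linear A) _; apply: linear_tmap.
have -> : conv f (conv g h) x =
    tlift *%R (tmap f (tlift *%R \o tmap g h) (tmap idfun comul (comul x))).
  by rewrite tmap_comp //; exact: comul_linear.
have -> : conv (conv f g) h x =
    tlift *%R (tmap (tlift *%R \o tmap f g) h (tmap comul idfun (comul x))).
  by rewrite tmap_comp //; exact: comul_linear.
(* Both sides are now linear functions of one element of [(C ⊗ C) ⊗ C]; generalising it allows a
   test on pure tensors. *)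
rewrite -comulA; move: (tmap comul idfun _) => y.
pose T := tlift *%R \o tmap f (tlift *%R \o tmap g h).
have lT : linear T.
  by apply: linear_comp (tlift_mul_linear A) _; apply: linear_tmap.
have lL : linear (T \o @tassoc k C C C).
  by apply: linear_comp lT _; apply: tassoc_linear.
have lR : linear (tlift *%R \o tmap (tlift *%R \o tmap f g) h).
  by apply: linear_comp (tlift_mul_linear A) _; apply: linear_tmap.
apply: (tensor_linear_ext lL lR) => {y} y c /=.
elim/tensor_ind: y => [|a b|y y' ey ey'].
- by rewrite !(bilin0l (pure_bilin _ _)) (linear0_ (@tassoc_linear _ _ _ _))
    [LHS](linear0_ lT) (linear0_ (linear_tmap _ _)) //
    (linear0_ (tlift_mul_linear A)).
- by rewrite tassoc_pure /T /= !tmapE // /= !tmapE // !tlift_mulE mulrA.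
- rewrite pureDl (linearD_ (@tassoc_linear _ _ _ _)) (linearD_ lT) ey ey'.
  by rewrite -(linearD_ lR).
Qed.

(** The product factors as [tmap counit idfun] followed by the action map [T] from [k ⊗ C] to [A],
    and the counit axiom evaluates the first factor. *)
Lemma conv1l f : linear f -> conv conv1 f =1 f.
Proof.
move=> lf x.
pose T : k^o ⊗ C -> A := tlift (fun (a : k^o) (c : C) => (a : k) *: f c).
have bT : bilin (fun (a : k^o) (c : C) => (a : k) *: f c).
  by split=> [c a b b'|b a c c']; rewrite ?lf ?scalerDl ?scalerDr !scalerA //
     mulrC.
have -> : conv conv1 f x = T (tmap counit idfun (comul x)).
  rewrite /conv; move: (comul x) => y.
  apply: (@tensor_linear_ext _ _ _ _ (tlift *%R \o tmap conv1 f)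
    (T \o tmap counit idfun)) => [||a b /=].
  - apply: linear_comp (tlift_mul_linear A) _.
    by apply: linear_tmap => //; exact: conv1_linear.
  - apply: linear_comp (tlift_linear bT) _.
    by apply: linear_tmap => //; exact: counit_linear.
  - rewrite !tmapE //; try exact: conv1_linear; try exact: counit_linear.
    by rewrite tlift_mulE /T (tlift_pure bT) /conv1 -scalerAl mul1r.
by rewrite counitl /T (tlift_pure bT) scale1r.
Qed.

Lemma conv1r f : linear f -> conv f conv1 =1 f.
Proof.
move=> lf x.
pose T : C ⊗ k^o -> A := tlift (fun (c : C) (a : k^o) => (a : k) *: f c).
have bT : bilin (fun (c : C) (a : k^o) => (a : k) *: f c).
  by split=> [b a c c'|c a b b']; rewrite ?lf ?scalerDl ?scalerDr !scalerA //
     mulrC.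
have -> : conv f conv1 x = T (tmap idfun counit (comul x)).
  rewrite /conv; move: (comul x) => y.
  apply: (@tensor_linear_ext _ _ _ _ (tlift *%R \o tmap f conv1)
    (T \o tmap idfun counit)) => [||a b /=].
  - apply: linear_comp (tlift_mul_linear A) _.
    by apply: linear_tmap => //; exact: conv1_linear.
  - apply: linear_comp (tlift_linear bT) _.
    by apply: linear_tmap => //; exact: counit_linear.
  - rewrite !tmapE //; try exact: conv1_linear; try exact: counit_linear.
    by rewrite tlift_mulE /T (tlift_pure bT) /conv1 -scalerAr mulr1.
by rewrite counitr /T (tlift_pure bT) scale1r.
Qed.

Definition conv_inverse f g : Prop := conv f g =1 conv1 /\ conv g f =1 conv1.

(** The usual monoid argument: g = g * (f * g') = (g * f) * g' = g', with * the convolution. *)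
Lemma conv_inverse_uniq f g g' : linear f -> linear g -> linear g' ->
  conv_inverse f g -> conv_inverse f g' -> g = g'.
Proof.
move=> lf lg lg' [_ /funext gf] [/funext fg' _]; apply: funext => x.
by rewrite -[LHS](conv1r lg) -fg' convA // gf conv1l.
Qed.

Lemma conv_inverse_conv f f' g g' :
  linear f -> linear f' -> linear g -> linear g' ->
  conv_inverse f f' -> conv_inverse g g' ->
  conv_inverse (conv f g) (conv g' f').
Proof.
move=> lf lf' lg lg' [/funext ff' /funext f'f] [/funext gg' /funext g'g].
have lgf' : linear (conv g' f') by exact: conv_linear.
have lfg : linear (conv f g) by exact: conv_linear.
split=> x.
  by rewrite -convA // (funext (convA lg lg' lf')) gg'
    (funext (conv1l lf')) ff'.
by rewrite -convA // (funext (convA lf' lf lg)) f'f (funext (conv1l lg)) g'g.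
Qed.

(** Since w = (g * f) * w = g * (f * w) under convolution, a left inverse of [f] allows [f] to be
    cancelled. This is the tool that makes defect terms vanish. *)
Lemma conv_cancell f g w : linear f -> linear g -> linear w ->
  conv g f =1 conv1 -> conv f w =1 (fun=> 0) -> w =1 (fun=> 0).
Proof.
move=> lf lg lw /funext gf /funext fw x.
rewrite -[LHS](conv1l lw) -gf -convA // fw.
have l0 : linear (fun _ : C => 0 : A) by move=> a y z; rewrite scaler0 addr0.
rewrite /conv; elim/tensor_ind: (comul x) => [|a b|y z ey ez].
- by rewrite (linear0_ (linear_tmap lg l0)) (linear0_ (tlift_mul_linear A)).
- by rewrite tmapE // tlift_mulE mulr0.
- rewrite (linearD_ (linear_tmap lg l0)) (linearD_ (tlift_mul_linear A)).
  by rewrite ey ez addr0.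
Qed.

End Convolution.

Arguments conv1 {k C} A x.

(** On a pure tensor this is multiplicativity of [m]. It transports convolution identities along
    algebra maps. *)
Lemma conv_morph (k : fieldType) (C : coalgType k) (A A' : comAlgType k)
    (m : A -> A') (f g : C -> A) :
  linear m -> {morph m : x y / x * y} -> linear f -> linear g ->
  forall x, m (conv f g x) = conv (m \o f) (m \o g) x.
Proof.
move=> lm mM lf lg x; rewrite /conv; move: (comul x) => y.
apply: (@tensor_linear_ext _ _ _ _ (m \o (tlift *%R \o tmap f g))
  (tlift *%R \o tmap (m \o f) (m \o g))) => [||a b /=].
- apply: linear_comp lm _; apply: linear_comp (tlift_mul_linear A) _.
  exact: linear_tmap.
- apply: linear_comp (tlift_mul_linear A') _.
  by apply: linear_tmap; apply: linear_comp.
- by rewrite !tmapE //; try apply: linear_comp => //; rewrite !tlift_mulE mM.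
Qed.

(** * Closure properties of bilinear maps, and extensionality on pure tensors *)

Section BilinearMaps.
Variable k : fieldType.

Lemma bilin_flip (U V W : lmodType k) (f : U -> V -> W) :
  bilin f -> bilin (fun x y => f y x).
Proof. by move=> [fl fr]; split. Qed.

Lemma bilin_comp (U U' V V' W : lmodType k) (f : U -> V -> W)
    (g : U' -> U) (h : V' -> V) :
  bilin f -> linear g -> linear h -> bilin (fun x y => f (g x) (h y)).
Proof.
move=> bf lg lh; split=> [w|v] a x y.
  by rewrite lg (bilinDl bf) (bilinZl bf).
by rewrite lh (bilinDr bf) (bilinZr bf).
Qed.

Lemma linear_bilin (U V W W' : lmodType k) (f : U -> V -> W) (g : W -> W') :
  linear g -> bilin f -> bilin (fun x y => g (f x y)).
Proof.
move=> lg bf; split=> [w|v] a x y.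
  by rewrite (bilinDl bf) (bilinZl bf) lg.
by rewrite (bilinDr bf) (bilinZr bf) lg.
Qed.

Lemma linear_opp (V : lmodType k) : linear (@GRing.opp V).
Proof. by move=> a x y; rewrite opprD scalerN. Qed.

Lemma bilin_add (U V W : lmodType k) (f g : U -> V -> W) :
  bilin f -> bilin g -> bilin (fun x y => f x y + g x y).
Proof. by move=> [fl fr] [gl gr]; split=> *; apply: linear_add. Qed.

Lemma bilin_sub (U V W : lmodType k) (f g : U -> V -> W) :
  bilin f -> bilin g -> bilin (fun x y => f x y - g x y).
Proof.
move=> bf bg; apply: bilin_add => //.
by apply: (linear_bilin (@linear_opp W)).
Qed.

(** Treats an integrand that depends linearly on a parameter, so that nested uses of [tlift] can be
    shown bilinear one level at a time. *)
Lemma bilin_tlift (Z V W U : lmodType k) (G : Z -> V -> W -> U) :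
  (forall z, bilin (G z)) -> (forall v w, linear (fun z => G z v w)) ->
  bilin (fun z x => tlift (G z) x).
Proof.
move=> bG lG; split=> [x a z z'|z]; last exact: tlift_linear.
elim/tensor_ind: x => [|v w|x y ex ey].
- by rewrite !(linear0_ (tlift_linear (bG _))) scaler0 addr0.
- by rewrite !tlift_pure // lG.
- by rewrite !(linearD_ (tlift_linear (bG _))) ex ey scalerDr addrACA.
Qed.

Lemma bilin_tensor_ext (V W V' W' U : lmodType k)
    (F G : V ⊗ W -> V' ⊗ W' -> U) : bilin F -> bilin G ->
  (forall a b c d, F (a ⊗ b) (c ⊗ d) = G (a ⊗ b) (c ⊗ d)) ->
  forall x y, F x y = G x y.
Proof.
move=> [Fl Fr] [Gl Gr] FG x y; move: x.
apply: tensor_linear_ext => // a b; move: y.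
by apply: tensor_linear_ext => // c d.
Qed.

End BilinearMaps.

(** * The Poisson bialgebra axioms in equational form *)

Section PoissonBialgebraTheory.
Variables (k : fieldType) (B : poissonBialgType k).

Lemma comul1 : comul (1 : B) = 1.
Proof. by case: (@comul_poisson _ B) => _ []. Qed.

Lemma comulM (x y : B) : comul (x * y) = comul x * comul y.
Proof. by case: (@comul_poisson _ B) => _ []. Qed.

Lemma comul_bracket (x y : B) : comul ⟦ x, y ⟧ = ⟦ comul x, comul y ⟧.
Proof. by case: (@comul_poisson _ B). Qed.

Lemma counit1 : counit (1 : B) = 1.
Proof. by case: (@counit_poisson _ B) => _ []. Qed.

Lemma counitM (x y : B) : counit (x * y) = counit x * counit y.
Proof. by case: (@counit_poisson _ B) => _ []. Qed.

Lemma counit_bracket (x y : B) : counit ⟦ x, y ⟧ = 0.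
Proof. by case: (@counit_poisson _ B) => _ _ ->. Qed.

End PoissonBialgebraTheory.

(** The Leibniz rule applied to [1 * 1] shows that the bracket equals twice itself. *)
Lemma bracketx1 (k : fieldType) (P : poissonAlgType k) (x : P) :
  ⟦ x, 1 ⟧ = 0.
Proof.
have := bracket_leibniz x 1 1.
rewrite !mulr1 mul1r => /eqP.
by rewrite -{1}[⟦ x, 1 ⟧]addr0 (inj_eq (addrI _)) eq_sym => /eqP.
Qed.

Lemma bracket1x (k : fieldType) (P : poissonAlgType k) (x : P) :
  ⟦ 1, x ⟧ = 0.
Proof. by rewrite bracketC bracketx1 oppr0. Qed.

(** * The convolution inverse of a Poisson map is multiplicative and reverses the bracket *)

Section ConvolutionInverse.
Variables (k : fieldType) (B : poissonBialgType k) (A : poissonAlgType k).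
Implicit Types (u v : B -> A) (X Y : B ⊗ B).

Lemma conv_tlift (f g : B -> A) X : linear f -> linear g ->
  tlift *%R (tmap f g X) = tlift (fun a b => f a * g b) X.
Proof.
move=> lf lg.
have bfg : bilin (fun a b => f a * g b).
  exact: bilin_comp (mul_bilin A) lf lg.
apply: (@tensor_linear_ext _ _ _ _ (tlift *%R \o tmap f g)) => [||a b /=].
- by apply: linear_comp (tlift_mul_linear A) _; apply: linear_tmap.
- exact: tlift_linear.
- by rewrite tmapE // tlift_mulE tlift_pure.
Qed.

(* For X = Delta x and Y = Delta y this is the sum of u(x_1) u(y_1) r(x_2, y_2),
   the convolution on B ⊗ B of u o mul and r. *)
Definition conv2_integrand u (r : B -> B -> A) X Y : A :=
  tlift (fun a b => u a * tlift (fun c d => u c * r b d) Y) X.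

Section Integrand.
Variables (u : B -> A) (r : B -> B -> A).
Hypotheses (lu : linear u) (br : bilin r).

Let b_inner b : bilin (fun c d => u c * r b d).
Proof. exact: bilin_comp (mul_bilin A) lu (br.2 b). Qed.

Let b_inner2 : bilin (fun b Y => tlift (fun c d => u c * r b d) Y).
Proof.
apply: bilin_tlift => // c d a x y.
by rewrite br.1 (bilinDr (mul_bilin A)) (bilinZr (mul_bilin A)).
Qed.

Let b_outer Y : bilin (fun a b => u a * tlift (fun c d => u c * r b d) Y).
Proof. exact: bilin_comp (mul_bilin A) lu (b_inner2.1 Y). Qed.

Lemma conv2_bilin : bilin (conv2_integrand u r).
Proof.
apply: bilin_flip; apply: bilin_tlift => // a b c x y.
by rewrite b_inner2.2 (bilinDr (mul_bilin A)) (bilinZr (mul_bilin A)).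
Qed.

Lemma conv2_pure a b c d :
  conv2_integrand u r (a ⊗ b) (c ⊗ d) = u a * (u c * r b d).
Proof. by rewrite /conv2_integrand !tlift_pure. Qed.

(** Two one-variable cancellations of [u]: the first in [y] with [x] fixed, the second in [x],
    applied to the integral over Delta y. *)
Lemma conv2_cancell v : linear v -> conv v u =1 conv1 A ->
  (forall x y, conv2_integrand u r (comul x) (comul y) = 0) ->
  forall x y, r x y = 0.
Proof.
move=> lv vu R0 x; apply: (conv_cancell lu lv (br.2 x) vu) => y.
have lw : linear (fun b => tlift (fun c d => u c * r b d) (comul y)).
  exact: b_inner2.1.
rewrite /conv conv_tlift //; last exact: br.2.
apply: (conv_cancell lu lv lw vu) => {}x.
by rewrite /conv conv_tlift //; exact: R0.
Qed.

End Integrand.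


Section Pairing.
Variables u v : B -> A.
Hypotheses (pu : poisson_morphism u) (lv : linear v).

Let lu : linear u. Proof. by case: pu. Qed.
Let u1 : u 1 = 1. Proof. by case: pu => _ []. Qed.
Let uM : {morph u : x y / x * y}. Proof. by case: pu => _ []. Qed.
Let uB : {morph u : x y / ⟦ x, y ⟧}. Proof. by case: pu. Qed.
Let mA := mul_bilin A.
Let bA := @bracket_bilin k A.
Let bB := @bracket_bilin k B.

(** The convolution of [u] and [v] is [M] after [comul]. Working with [M] on all of [B ⊗ B] makes
    identities testable on pure tensors. *)
Let M X : A := tlift (fun a b => u a * v b) X.

Let bM : bilin (fun a b => u a * v b). Proof. exact: bilin_comp mA lu lv. Qed.
Let lM : linear M. Proof. exact: tlift_linear. Qed.
Let ME a b : M (a ⊗ b) = u a * v b. Proof. exact: tlift_pure. Qed.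

Let convM x : conv u v x = M (comul x). Proof. exact: conv_tlift. Qed.

Let mul_defect x y := v (x * y) - v x * v y.
(** The sign is plus because [v] is expected to reverse the bracket. *)
Let bracket_defect x y := v ⟦ x, y ⟧ + ⟦ v x, v y ⟧.

Let mul_defect_bilin : bilin mul_defect.
Proof.
apply: bilin_sub; first exact: linear_bilin lv (mul_bilin B).
exact: bilin_comp mA lv lv.
Qed.

Let bracket_defect_bilin : bilin bracket_defect.
Proof.
apply: bilin_add; first exact: linear_bilin lv bB.
exact: bilin_comp bA lv lv.
Qed.

(** On pure tensors both sides equal [u a * u c * v (b * d)]: the product of the two values of [M]
    cancels the subtracted half of the defect, by commutativity of [A]. *)
Let pairing_mul X Y : 
  M (X * Y) = M X * M Y + conv2_integrand u mul_defect X Y.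
Proof.
move: X Y; apply: bilin_tensor_ext => [||a b c d].
- exact: linear_bilin lM (mul_bilin _).
- apply: bilin_add; first exact: bilin_comp mA lM lM.
  exact: conv2_bilin.
- rewrite mul_pure !ME (conv2_pure lu mul_defect_bilin) /mul_defect uM.
  by ring.
Qed.

(* For X = Delta x and Y = Delta y, N1 (M X) Y = [u(x_1) v(x_2), u(y_1)] v(y_2)
   and N2 (M Y) X = u(x_1) [v(x_2), u(y_1) v(y_2)].  Both vanish once M X and M Y
   are scalars, and the terms in [v(x_2), u(y_1)] cancel in their difference. *)
Let N1 Z Y : A := tlift (fun c d => ⟦ Z, u c ⟧ * v d) Y.
Let N2 Z X : A := tlift (fun a b => u a * ⟦ v b, Z ⟧) X.

Let bN1_in Z : bilin (fun c d => ⟦ Z, u c ⟧ * v d).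
Proof.
exact: (bilin_comp mA (linear_comp (bA.2 Z) lu) lv).
Qed.

Let bN1 : bilin N1.
Proof.
refine (bilin_tlift bN1_in _) => c d a x y.
by rewrite (bilinDl bA) (bilinZl bA) (bilinDl mA) (bilinZl mA).
Qed.

Let bN2_in Z : bilin (fun a b => u a * ⟦ v b, Z ⟧).
Proof.
exact: (bilin_comp mA lu (linear_comp (bA.1 Z) lv)).
Qed.

Let bN2 : bilin N2.
Proof.
refine (bilin_tlift bN2_in _) => c d a x y.
by rewrite (bilinDr bA) (bilinZr bA) (bilinDr mA) (bilinZr mA).
Qed.

Let pairing_bracket X Y : {morph v : x y / x * y} ->
  M ⟦ X, Y ⟧ =
    N1 (M X) Y - N2 (M Y) X + conv2_integrand u bracket_defect X Y.
Proof.
move=> vM; move: X Y; apply: bilin_tensor_ext => [||a b c d].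
- exact: linear_bilin lM (@bracket_bilin k _).
- apply: bilin_add; last exact: conv2_bilin.
  apply: bilin_sub; first exact: bilin_comp bN1 lM (@linear_id _ _).
  by apply: bilin_flip; exact: bilin_comp bN2 lM (@linear_id _ _).
- rewrite [⟦ _, _ ⟧]tbracket_pure (linearD_ lM) !ME.
  rewrite (conv2_pure lu bracket_defect_bilin) /bracket_defect.
  rewrite /N1 /N2 !tlift_pure // uM uB vM.
  rewrite bracket_leibniz [⟦ _ * _, u c ⟧]bracketC bracket_leibniz.
  rewrite [⟦ u c, u a ⟧]bracketC [⟦ u c, v b ⟧]bracketC; by ring.
Qed.

Let N1_scalar c Y : N1 (c *: 1) Y = 0.
Proof.
rewrite (bilinZl bN1) /N1 /tlift big1 ?scaler0 // => p _.
by rewrite bracket1x mul0r.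
Qed.

Let N2_scalar c X : N2 (c *: 1) X = 0.
Proof.
rewrite (bilinZl bN2) /N2 /tlift big1 ?scaler0 // => p _.
by rewrite bracketx1 mulr0.
Qed.

(** The hypotheses are about the two elements [x] and [y] only, so the formula serves both for a
    full convolution inverse and for an induction over elements. *)
Let conv_mul x y : conv u v x = conv1 A x -> conv u v y = conv1 A y ->
  conv u v (x * y) =
    conv1 A (x * y) + conv2_integrand u mul_defect (comul x) (comul y).
Proof.
rewrite !convM comulM pairing_mul => -> ->.
by rewrite /conv1 counitM -scalerAl mul1r scalerA.
Qed.

Let conv_bracket x y : {morph v : x y / x * y} ->
  conv u v x = conv1 A x -> conv u v y = conv1 A y ->
  conv u v ⟦ x, y ⟧ = conv2_integrand u bracket_defect (comul x) (comul y).
Proof.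
rewrite !convM comul_bracket => vM; rewrite pairing_bracket // => -> ->.
by rewrite N1_scalar N2_scalar subr0 add0r.
Qed.

(** As the convolution is known on [x], [y] and [x * y], the extra term in [conv_mul] must vanish;
    cancelling [u] twice leaves a zero defect. *)
Lemma inverse_monoid_morphism : conv_inverse u v -> monoid_morphism v.
Proof.
move=> [uv vu]; split=> [|x y].
  have := uv 1; rewrite convM comul1 ME u1 mul1r => ->.
  by rewrite /conv1 counit1 scale1r.
apply/eqP; rewrite -subr_eq0; apply/eqP.
apply: (conv2_cancell lu mul_defect_bilin lv vu) => {}x {}y.
have /eqP := conv_mul (uv x) (uv y).
by rewrite uv -{1}[conv1 _ _]addr0 (inj_eq (addrI _)) eq_sym => /eqP.
Qed.

Lemma inverse_bracket : conv_inverse u v ->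
  {morph v : x y / ⟦ x, y ⟧ >-> - ⟦ x, y ⟧}.
Proof.
move=> uv x y; have [_ vM] := inverse_monoid_morphism uv.
case: uv => uv vu.
apply/eqP; rewrite -addr_eq0; apply/eqP.
apply: (conv2_cancell lu bracket_defect_bilin lv vu) => {}x {}y.
by rewrite -conv_bracket // uv /conv1 counit_bracket scale0r.
Qed.

(** The same formula read backwards: for multiplicative [v] the defect term is zero, so the elements
    where [u] and [v] convolve to the unit are closed under products. The bracket version
    follows. *)
Lemma conv_counitM x y : {morph v : x y / x * y} ->
  conv u v x = conv1 A x -> conv u v y = conv1 A y ->
  conv u v (x * y) = conv1 A (x * y).
Proof.
move=> vM ex ey; rewrite conv_mul // /conv2_integrand /tlift.
rewrite big1 ?addr0 // => p _; rewrite big1 ?mulr0 // => q _.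
by rewrite /mul_defect vM subrr mulr0.
Qed.

Lemma conv_counit_bracket x y : {morph v : x y / x * y} ->
  {morph v : x y / ⟦ x, y ⟧ >-> - ⟦ x, y ⟧} ->
  conv u v x = conv1 A x -> conv u v y = conv1 A y ->
  conv u v ⟦ x, y ⟧ = conv1 A ⟦ x, y ⟧.
Proof.
move=> vM vB ex ey; rewrite conv_bracket // /conv2_integrand /tlift.
rewrite /conv1 counit_bracket scale0r.
rewrite big1 // => p _; rewrite big1 ?mulr0 // => q _.
by rewrite /bracket_defect vB addNr mulr0.
Qed.

End Pairing.

End ConvolutionInverse.

(** * The Poisson algebra with opposite bracket *)

Section OppositeBracket.
Variables (k : fieldType) (P : poissonAlgType k).

(** A type alias that keeps the commutative algebra structure and can carry a second bracket;
    bracket-reversing algebra maps into [P] become Poisson maps into it. *)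
Definition opp_bracket_alg : Type := P.
HB.instance Definition _ := GRing.ComAlgebra.on opp_bracket_alg.
Implicit Types x y z : opp_bracket_alg.

Definition opp_bracket x y : opp_bracket_alg := - ⟦ (x : P), (y : P) ⟧.

Lemma opp_bracket_bilin : bilin opp_bracket.
Proof. exact: linear_bilin (@linear_opp k P) (@bracket_bilin k P). Qed.

Lemma opp_bracketxx x : opp_bracket x x = 0.
Proof. by rewrite /opp_bracket bracketxx oppr0. Qed.

Lemma opp_bracket_jacobi x y z :
  opp_bracket x (opp_bracket y z) + opp_bracket y (opp_bracket z x)
    + opp_bracket z (opp_bracket x y) = 0.
Proof.
have brN (a b : P) : ⟦ a, - b ⟧ = - ⟦ a, b ⟧.
  by rewrite -scaleN1r (bilinZr bracket_bilin) scaleN1r.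
by rewrite /opp_bracket !brN !opprK; exact: bracket_jacobi.
Qed.

HB.instance Definition _ := isLieAlgebra.Build k opp_bracket_alg
  opp_bracket_bilin opp_bracketxx opp_bracket_jacobi.

Lemma opp_bracket_leibniz x y z :
  ⟦ x, y * z ⟧ = ⟦ x, y ⟧ * z + y * ⟦ x, z ⟧.
Proof.
rewrite /bracket /= /opp_bracket [X in - X = _](bracket_leibniz (x : P)).
by rewrite opprD mulNr mulrN.
Qed.

HB.instance Definition _ := isPoissonAlgebra.Build k opp_bracket_alg
  opp_bracket_leibniz.

End OppositeBracket.

(** * Poisson morphisms between tensor products *)

Section PoissonMorphisms.
Variable k : fieldType.

Lemma poisson_comp (P Q R : poissonAlgType k) (g : Q -> R) (f : P -> Q) :
  poisson_morphism g -> poisson_morphism f -> poisson_morphism (g \o f).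
Proof.
move=> [lg [g1 gM] gB] [lf [f1 fM] fB]; split.
- exact: linear_comp.
- by split=> [|x y] /=; rewrite ?f1 ?fM.
- by move=> x y /=; rewrite fB gB.
Qed.

Lemma poisson_id (P : poissonAlgType k) : poisson_morphism (@idfun P).
Proof. by []. Qed.

Lemma poisson_tmap (P P' Q Q' : poissonAlgType k) (f : P -> P') (g : Q -> Q') :
  poisson_morphism f -> poisson_morphism g -> poisson_morphism (tmap f g).
Proof.
move=> [lf [f1 fM] fB] [lg [g1 gM] gB].
have lt := linear_tmap lf lg; split=> //; first split.
- by rewrite tmapE // f1 g1.
- apply: bilin_tensor_ext => [||a b c d].
  + exact: linear_bilin lt (mul_bilin _).
  + exact: (bilin_comp (mul_bilin _) lt lt).
  + by rewrite mul_pure !tmapE // fM gM mul_pure.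
- apply: bilin_tensor_ext => [||a b c d].
  + exact: linear_bilin lt (@bracket_bilin k _).
  + exact: (bilin_comp (@bracket_bilin k _) lt lt).
  + rewrite [in LHS]/bracket /= tbracket_pure (linearD_ lt) !tmapE //.
    by rewrite fM gM fB gB [RHS]tbracket_pure.
Qed.

Lemma bilin_tensor3_ext (U V W U' V' W' Z : lmodType k)
    (F G : U ⊗ V ⊗ W -> U' ⊗ V' ⊗ W' -> Z) : bilin F -> bilin G ->
  (forall a b c a' b' c', F (a ⊗ b ⊗ c) (a' ⊗ b' ⊗ c')
    = G (a ⊗ b ⊗ c) (a' ⊗ b' ⊗ c')) ->
  forall x y, F x y = G x y.
Proof.
move=> bF bG FG; apply: bilin_tensor_ext => // x c y c'; move: x y.
have pl (V1 V2 : lmodType k) (w : V2) : linear (fun v : V1 => v ⊗ w).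
  exact: (pure_bilin V1 V2).1.
apply: bilin_tensor_ext => //.
- exact: bilin_comp bF (pl _ _ c) (pl _ _ c').
- exact: bilin_comp bG (pl _ _ c) (pl _ _ c').
Qed.

Lemma poisson_tassoc (P Q R : poissonAlgType k) :
  poisson_morphism (@tassoc k P Q R).
Proof.
have lt := @tassoc_linear k P Q R; split=> //; first split.
- exact: tassoc_pure.
- apply: bilin_tensor3_ext => [||a b c a' b' c'].
  + exact: linear_bilin lt (mul_bilin _).
  + exact: (bilin_comp (mul_bilin _) lt lt).
  + by rewrite !mul_pure !tassoc_pure !mul_pure.
- apply: bilin_tensor3_ext => [||a b c a' b' c'].
  + exact: linear_bilin lt (@bracket_bilin k _).
  + exact: (bilin_comp (@bracket_bilin k _) lt lt).
  + have brE (X Y : poissonAlgType k) (x x' : X) (y y' : Y) :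
      ⟦ x ⊗ y, x' ⊗ y' ⟧ =
        (x * x') ⊗ ⟦ y, y' ⟧ + ⟦ x, x' ⟧ ⊗ (y * y').
      exact: tbracket_pure.
    rewrite !tassoc_pure !brE mul_pure pureDl pureDr !(linearD_ lt).
    by rewrite !tassoc_pure !mul_pure addrA.
Qed.

Lemma poisson_pure1l (P Q : poissonAlgType k) :
  poisson_morphism (fun x : P => x ⊗ (1 : Q)).
Proof.
split; first exact: (pure_bilin _ _).1.
- by split=> // x y; rewrite mul_pure mul1r.
- move=> x y; rewrite [RHS]tbracket_pure bracketxx mul1r.
  by rewrite (bilin0r (pure_bilin _ _)) add0r.
Qed.

Lemma poisson_pure1r (P Q : poissonAlgType k) :
  poisson_morphism (fun y : Q => (1 : P) ⊗ y).
Proof.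
split; first exact: (pure_bilin _ _).2.
- by split=> // x y; rewrite mul_pure mul1r.
- move=> x y; rewrite [RHS]tbracket_pure bracketxx mul1r.
  by rewrite (bilin0l (pure_bilin _ _)) addr0.
Qed.

End PoissonMorphisms.

(** * The Poisson algebra generated by a universal convolution-invertible Poisson map *)

Section FreePoissonHopf.
Variables (k : fieldType) (B : poissonBialgType k).

(** Only linearity is asked of [v]: its behaviour on products and brackets is forced by that of
    [u]. *)
Definition invertible_pair (A : poissonAlgType k) (u v : B -> A) : Prop :=
  [/\ poisson_morphism u, linear v & conv_inverse u v].

Lemma invertible_pair_opp (A : poissonAlgType k) (u v : B -> A) :
  invertible_pair u v ->
  invertible_pair (v : B -> opp_bracket_alg A) (u : B -> opp_bracket_alg A).
Proof.
move=> [pu lv uv]; split; last by split; [exact: uv.2 | exact: uv.1].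
- split=> //; first exact: inverse_monoid_morphism pu lv uv.
  exact: inverse_bracket pu lv uv.
- by case: pu.
Qed.

(** An algebra map preserves convolution products and the convolution unit, hence inverses. *)
Lemma invertible_pair_comp (A A' : poissonAlgType k) (m : A -> A')
    (u v : B -> A) :
  poisson_morphism m -> invertible_pair u v ->
  invertible_pair (m \o u) (m \o v).
Proof.
move=> pm [pu lv [uv vu]]; have [lm [m1 mM] _] := pm; have [lu _ _] := pu.
split; [exact: poisson_comp|exact: linear_comp|].
by split=> x; rewrite -conv_morph // ?uv ?vu /conv1 (linearZ_ lm) m1.
Qed.

(** The counit is the convolution unit for the target [k], hence its own inverse. *)
Lemma invertible_pair_counit :
  invertible_pair (counit : B -> k^o) (counit : B -> k^o).
Proof.
have lc : linear (counit : B -> k^o) by exact: counit_linear.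
have c1 : (counit : B -> k^o) = conv1 (k^o : comAlgType k).
  by apply: funext => x; rewrite /conv1 [RHS]mulr1.
split; [exact: counit_poisson|exact: lc|].
by split=> x; rewrite {1}c1 conv1l // [in LHS]c1.
Qed.

Inductive hopf_term : Type :=
| Gen of B
| InvGen of B
| One
| Add of hopf_term & hopf_term
| Mul of hopf_term & hopf_term
| Scale of k & hopf_term
| Bracket of hopf_term & hopf_term.

Fixpoint term_eval (A : poissonAlgType k) (u v : B -> A) (t : hopf_term) : A :=
  match t with
  | Gen b => u b
  | InvGen b => v b
  | One => 1
  | Add s t => term_eval u v s + term_eval u v t
  | Mul s t => term_eval u v s * term_eval u v t
  | Scale a t => a *: term_eval u v t
  | Bracket s t => ⟦ term_eval u v s, term_eval u v t ⟧
  end.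

(* Quantifying over all targets makes every identity of Poisson algebras hold in
   the quotient, so no congruence has to be generated by hand. *)
Definition term_equiv (s t : hopf_term) : Prop :=
  forall (A : poissonAlgType k) (u v : B -> A),
    invertible_pair u v -> term_eval u v s = term_eval u v t.

HB.instance Definition _ := gen_eqMixin hopf_term.
HB.instance Definition _ := gen_choiceMixin hopf_term.

Definition term_eqb : rel hopf_term := fun s t => `[< term_equiv s t >].

Lemma term_eqb_refl : reflexive term_eqb.
Proof. by move=> s; apply/asboolP. Qed.

Lemma term_eqb_sym : symmetric term_eqb.
Proof.
by move=> s t; apply: asbool_equiv_eq; split=> st A u v uv; rewrite st.
Qed.

Lemma term_eqb_trans : transitive term_eqb.
Proof.
move=> t s r /asboolP st /asboolP tr; apply/asboolP => A u v uv.
by rewrite st // tr.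
Qed.

Canonical term_equivrel :=
  EquivRel term_eqb term_eqb_refl term_eqb_sym term_eqb_trans.

Definition free_hopf : Type := {eq_quot term_eqb}.
HB.instance Definition _ := Choice.on free_hopf.
Implicit Types x y z : free_hopf.

Definition hclass (t : hopf_term) : free_hopf := \pi_{eq_quot term_eqb} t.
Definition hrepr x : hopf_term := repr (x : {eq_quot term_eqb}).

Lemma hreprK x : hclass (hrepr x) = x. Proof. exact: reprK. Qed.

(** Evaluation at the chosen representative; independence of that choice is [liftE] and uses that
    the pair is invertible. *)
Definition hlift (A : poissonAlgType k) (u v : B -> A) x : A :=
  term_eval u v (hrepr x).

Lemma liftE (A : poissonAlgType k) (u v : B -> A) : invertible_pair u v ->
  forall t, hlift u v (hclass t) = term_eval u v t.
Proof.
move=> uv t; have: hclass (hrepr (hclass t)) = hclass t by exact: hreprK.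
by move=> /eqmodP/asboolP; apply.
Qed.

(** The evaluations separate points by construction of the quotient. Every axiom below is therefore
    checked in an arbitrary target, where it already holds. *)
Lemma free_hopf_eqP x y :
  (forall (A : poissonAlgType k) (u v : B -> A), invertible_pair u v ->
    hlift u v x = hlift u v y) -> x = y.
Proof.
move=> xy; rewrite -[x]hreprK -[y]hreprK.
by apply/eqmodP/asboolP => A u v uv; exact: xy.
Qed.

(** * The Poisson algebra structure on the quotient *)

Definition hzero : free_hopf := hclass (Scale 0 One).
Definition hone : free_hopf := hclass One.
Definition hadd x y : free_hopf := hclass (Add (hrepr x) (hrepr y)).
Definition hopp x : free_hopf := hclass (Scale (-1) (hrepr x)).
Definition hmul x y : free_hopf := hclass (Mul (hrepr x) (hrepr y)).
Definition hscale a x : free_hopf := hclass (Scale a (hrepr x)).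
Definition hbracket x y : free_hopf := hclass (Bracket (hrepr x) (hrepr y)).

Section Lift.
Variables (A : poissonAlgType k) (u v : B -> A).
Hypothesis uv : invertible_pair u v.

Lemma lift_hzero : hlift u v hzero = 0.
Proof. by rewrite liftE // /= scale0r. Qed.
Lemma lift_hone : hlift u v hone = 1.
Proof. exact: liftE. Qed.
Lemma lift_hadd x y : hlift u v (hadd x y) = hlift u v x + hlift u v y.
Proof. exact: liftE. Qed.
Lemma lift_hopp x : hlift u v (hopp x) = - hlift u v x.
Proof. by rewrite liftE // /= scaleN1r. Qed.
Lemma lift_hmul x y : hlift u v (hmul x y) = hlift u v x * hlift u v y.
Proof. exact: liftE. Qed.
Lemma lift_hscale a x : hlift u v (hscale a x) = a *: hlift u v x.
Proof. exact: liftE. Qed.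
Lemma lift_hbracket x y :
  hlift u v (hbracket x y) = ⟦ hlift u v x, hlift u v y ⟧.
Proof. exact: liftE. Qed.

Definition lift_hE := (lift_hzero, lift_hone, lift_hadd, lift_hopp, lift_hmul,
  lift_hscale, lift_hbracket).
End Lift.

Lemma haddA : associative hadd.
Proof.
by move=> x y z; apply: free_hopf_eqP => A u v uv; rewrite !lift_hE // addrA.
Qed.
Lemma haddC : commutative hadd.
Proof.
by move=> x y; apply: free_hopf_eqP => A u v uv; rewrite !lift_hE // addrC.
Qed.
Lemma hadd0 : left_id hzero hadd.
Proof.
by move=> x; apply: free_hopf_eqP => A u v uv; rewrite !lift_hE // add0r.
Qed.
Lemma haddN : left_inverse hzero hopp hadd.
Proof.
by move=> x; apply: free_hopf_eqP => A u v uv; rewrite !lift_hE // addNr.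
Qed.

HB.instance Definition _ :=
  GRing.isZmodule.Build free_hopf haddA haddC hadd0 haddN.

Lemma hmulA : associative hmul.
Proof.
by move=> x y z; apply: free_hopf_eqP => A u v uv; rewrite !lift_hE // mulrA.
Qed.
Lemma hmulC : commutative hmul.
Proof.
by move=> x y; apply: free_hopf_eqP => A u v uv; rewrite !lift_hE // mulrC.
Qed.
Lemma hmul1 : left_id hone hmul.
Proof.
by move=> x; apply: free_hopf_eqP => A u v uv; rewrite !lift_hE // mul1r.
Qed.
Lemma hmulDl : left_distributive hmul hadd.
Proof.
by move=> x y z; apply: free_hopf_eqP => A u v uv; rewrite !lift_hE // mulrDl.
Qed.
Lemma hone_neq0 : hone != hzero.
Proof.
(* Evaluation at the counit pair separates one from zero in [k]. *)
apply/eqP => /(congr1 (hlift counit counit)).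
rewrite !lift_hE; try exact: invertible_pair_counit.
by move/eqP; rewrite oner_eq0.
Qed.

HB.instance Definition _ := GRing.Zmodule_isComNzRing.Build free_hopf
  hmulA hmulC hmul1 hmulDl hone_neq0.

Lemma hscaleA a b x : hscale a (hscale b x) = hscale (a * b) x.
Proof. by apply: free_hopf_eqP => A u v uv; rewrite !lift_hE // scalerA. Qed.
Lemma hscale1 : left_id 1 hscale.
Proof.
by move=> x; apply: free_hopf_eqP => A u v uv; rewrite !lift_hE // scale1r.
Qed.
Lemma hscaleDr : right_distributive hscale hadd.
Proof.
by move=> a x y; apply: free_hopf_eqP => A u v uv; rewrite !lift_hE // scalerDr.
Qed.
Lemma hscaleDl x : {morph hscale^~ x : a b / a + b >-> hadd a b}.
Proof.
by move=> a b; apply: free_hopf_eqP => A u v uv; rewrite !lift_hE // scalerDl.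
Qed.

HB.instance Definition _ := GRing.Zmodule_isLmodule.Build k free_hopf
  hscaleA hscale1 hscaleDr hscaleDl.

Lemma hscaleAl a x y : hscale a (hmul x y) = hmul (hscale a x) y.
Proof. by apply: free_hopf_eqP => A u v uv; rewrite !lift_hE // scalerAl. Qed.

HB.instance Definition _ := GRing.Lmodule_isLalgebra.Build k free_hopf hscaleAl.
HB.instance Definition _ := GRing.Lalgebra_isComAlgebra.Build k free_hopf.

Section LiftMorphism.
Variables (A : poissonAlgType k) (u v : B -> A).
Hypothesis uv : invertible_pair u v.

Lemma lift_linear : linear (hlift u v).
Proof. by move=> a x y; rewrite (lift_hadd uv) (lift_hscale uv). Qed.
Lemma lift_monoid_morphism : monoid_morphism (hlift u v).
Proof. by split=> [|x y]; [exact: lift_hone | exact: lift_hmul]. Qed.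

End LiftMorphism.

Lemma hbracket_bilin : bilin hbracket.
Proof.
split=> [w|w] a x y; apply: free_hopf_eqP => A u v uv;
  rewrite lift_hbracket // !(lift_linear uv) !lift_hbracket //.
  by rewrite (bracket_bilin.1 _).
by rewrite (bracket_bilin.2 _).
Qed.
Lemma hbracketxx x : hbracket x x = 0.
Proof.
apply: free_hopf_eqP => A u v uv.
by rewrite lift_hbracket // bracketxx (linear0_ (lift_linear uv)).
Qed.
Lemma hbracket_jacobi x y z :
  hbracket x (hbracket y z) + hbracket y (hbracket z x)
    + hbracket z (hbracket x y) = 0.
Proof.
apply: free_hopf_eqP => A u v uv.
rewrite !(linearD_ (lift_linear uv)) !lift_hbracket // bracket_jacobi.
by rewrite (linear0_ (lift_linear uv)).
Qed.

HB.instance Definition _ := isLieAlgebra.Build k free_hopf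
  hbracket_bilin hbracketxx hbracket_jacobi.

Lemma hbracket_leibniz x y z :
  ⟦ x, y * z ⟧ = ⟦ x, y ⟧ * z + y * ⟦ x, z ⟧.
Proof.
apply: free_hopf_eqP => A u v uv.
rewrite (linearD_ (lift_linear uv)) !(lift_monoid_morphism uv).2.
rewrite !lift_hbracket //.
by rewrite (lift_monoid_morphism uv).2 bracket_leibniz.
Qed.

HB.instance Definition _ := isPoissonAlgebra.Build k free_hopf hbracket_leibniz.

Lemma poisson_lift (A : poissonAlgType k) (u v : B -> A) :
  invertible_pair u v -> poisson_morphism (hlift u v).
Proof.
move=> uv; split; [exact: lift_linear|exact: lift_monoid_morphism|].
exact: lift_hbracket.
Qed.

(** * The universal invertible pair *)

Definition gen (b : B) : free_hopf := hclass (Gen b).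
Definition inv_gen (b : B) : free_hopf := hclass (InvGen b).

Lemma lift_gen (A : poissonAlgType k) (u v : B -> A) : invertible_pair u v ->
  hlift u v \o gen = u.
Proof. by move=> uv; apply: funext => b; exact: liftE. Qed.

Lemma lift_inv_gen (A : poissonAlgType k) (u v : B -> A) :
  invertible_pair u v -> hlift u v \o inv_gen = v.
Proof. by move=> uv; apply: funext => b; exact: liftE. Qed.

(** Induction on a representing term. Zero needs no clause, being the class of [Scale 0 One]. *)
Lemma free_hopf_ind (P : free_hopf -> Prop) :
  (forall b, P (gen b)) -> (forall b, P (inv_gen b)) -> P 1 ->
  (forall x y, P x -> P y -> P (x + y)) ->
  (forall x y, P x -> P y -> P (x * y)) ->
  (forall a x, P x -> P (a *: x)) ->
  (forall x y, P x -> P y -> P ⟦ x, y ⟧) ->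
  forall x, P x.
Proof.
move=> Pg Pi P1 PD PM PZ PB x; rewrite -[x]hreprK; elim: (hrepr x) => //.
- move=> s Ps t Pt; have := PD _ _ Ps Pt; congr P.
  by apply: free_hopf_eqP => A u v uv; rewrite lift_hadd ?liftE.
- move=> s Ps t Pt; have := PM _ _ Ps Pt; congr P.
  by apply: free_hopf_eqP => A u v uv; rewrite lift_hmul ?liftE.
- move=> a t Pt; have := PZ a _ Pt; congr P.
  by apply: free_hopf_eqP => A u v uv; rewrite lift_hscale ?liftE.
- move=> s Ps t Pt; have := PB _ _ Ps Pt; congr P.
  by apply: free_hopf_eqP => A u v uv; rewrite lift_hbracket ?liftE.
Qed.

(** Each condition is tested under every [hlift u v], which preserves the operations and convolution
    and sends the pair to [u], [v], where the condition holds by assumption. *)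
Lemma invertible_pair_gen : invertible_pair gen inv_gen.
Proof.
have lgen : linear gen.
  move=> a x y; apply: free_hopf_eqP => A u v uv; rewrite lift_linear //.
  by rewrite !liftE //=; case: uv => -[->].
have linv : linear inv_gen.
  move=> a x y; apply: free_hopf_eqP => A u v uv; rewrite lift_linear //.
  by rewrite !liftE //=; case: uv => _ ->.
split=> //.
  split=> //; last first.
    move=> x y; apply: free_hopf_eqP => A u v uv; rewrite lift_hbracket //.
    by rewrite !liftE //=; case: uv => -[_ _ ->].
  split=> [|x y]; apply: free_hopf_eqP => A u v uv.
    by rewrite lift_hone // liftE //=; case: uv => -[_ [-> _]].
  by rewrite lift_hmul // !liftE //=; case: uv => -[_ [_ ->]].
split=> x; apply: free_hopf_eqP => A u v uv;
  have [ll [l1 lM] _] := poisson_lift uv; rewrite conv_morph //;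
  rewrite lift_gen // lift_inv_gen // /conv1 (linearZ_ ll) l1;
  by case: uv => _ _ [uv1 uv2]; rewrite ?uv1 ?uv2.
Qed.

Lemma free_hopf_ext (A : poissonAlgType k) (f g : free_hopf -> A) :
  poisson_morphism f -> poisson_morphism g -> f \o gen = g \o gen -> f =1 g.
Proof.
move=> pf pg fg.
have [[lu _ _] lv uv] := invertible_pair_comp pf invertible_pair_gen.
have [_ lv' uv'] := invertible_pair_comp pg invertible_pair_gen.
(* Both composites are convolution inverses of the same map [f \o gen], so agreement on [gen] forces
   agreement on [inv_gen]. *)
have fgI : f \o inv_gen = g \o inv_gen.
  by apply: conv_inverse_uniq lu lv lv' uv _; rewrite fg.
case: pf pg => lf [f1 fM] fB [lg [g1 gM] gB].
elim/free_hopf_ind => [b|b||x y ex ey|x y ex ey|a x ex|x y ex ey].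
- exact: (congr1 (fun h => h b) fg).
- exact: (congr1 (fun h => h b) fgI).
- by rewrite f1 g1.
- by rewrite (linearD_ lf) (linearD_ lg) ex ey.
- by rewrite fM gM ex ey.
- by rewrite (linearZ_ lf) (linearZ_ lg) ex.
- by rewrite fB gB ex ey.
Qed.

End FreePoissonHopf.

Arguments gen {k B} b.
Arguments inv_gen {k B} b.

(** Naturality of the associator, used for coassociativity on generators. *)
Lemma tassoc_tmap (k : fieldType) (U V W U' V' W' : lmodType k)
    (f : U -> U') (g : V -> V') (h : W -> W') :
  linear f -> linear g -> linear h -> forall x,
  tassoc (tmap (tmap f g) h x) = tmap f (tmap g h) (tassoc x).
Proof.
move=> lf lg lh.
have lgh := linear_tmap lg lh; have lfg := linear_tmap lf lg.
apply: (@tensor_linear_ext _ _ _ _ (@tassoc k U' V' W' \o tmap (tmap f g) h)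
  (tmap f (tmap g h) \o @tassoc k U V W)) => [||y c /=].
- by apply: linear_comp (@tassoc_linear _ _ _ _) _; apply: linear_tmap.
- by apply: linear_comp (@tassoc_linear _ _ _ _); apply: linear_tmap.
rewrite tmapE //.
have lL : linear (fun y => tassoc (tmap f g y ⊗ h c)).
  move=> a z z'.
  rewrite lfg (bilinDl (pure_bilin _ _)) (bilinZl (pure_bilin _ _)).
  exact: tassoc_linear.
have lR : linear (fun y => tmap f (tmap g h) (tassoc (y ⊗ c))).
  move=> a z z'; rewrite (bilinDl (pure_bilin _ _)) (bilinZl (pure_bilin _ _)).
  by rewrite tassoc_linear linear_tmap.
apply: (tensor_linear_ext lL lR) => a b.
by rewrite tmapE // !tassoc_pure !tmapE.
Qed.

(** * The Poisson bialgebra structure of G(B) *)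

Section FreePoissonHopfStructure.
Variables (k : fieldType) (B : poissonBialgType k).
Let G := free_hopf B.

Let pu : poisson_morphism (@gen k B).
Proof. by case: (invertible_pair_gen B). Qed.
Let lu : linear (@gen k B). Proof. by case: pu. Qed.
Let lv : linear (@inv_gen k B). Proof. by case: (invertible_pair_gen B). Qed.

(* tmap gen gen o Delta is the convolution product of gen ⊗ 1 and 1 ⊗ gen, whose
   inverse is the product of the inverses in the opposite order. *)
Definition inl_gen b : G ⊗ G := gen b ⊗ 1.
Definition inr_gen b : G ⊗ G := 1 ⊗ gen b.
Definition inl_inv b : G ⊗ G := inv_gen b ⊗ 1.
Definition inr_inv b : G ⊗ G := 1 ⊗ inv_gen b.

Lemma invertible_pair_inl : invertible_pair inl_gen inl_inv.
Proof.
exact: invertible_pair_comp (poisson_pure1l G G) (invertible_pair_gen B).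
Qed.

Lemma invertible_pair_inr : invertible_pair inr_gen inr_inv.
Proof.
exact: invertible_pair_comp (poisson_pure1r G G) (invertible_pair_gen B).
Qed.

Lemma tmap_gen_comul : tmap gen gen \o comul = conv inl_gen inr_gen.
Proof.
have [[l1 _ _] _ _] := invertible_pair_inl.
have [[l2 _ _] _ _] := invertible_pair_inr.
apply: funext => x; rewrite /conv /=; move: (comul x).
apply: (@tensor_linear_ext _ _ _ _ _ (tlift *%R \o tmap inl_gen inr_gen))
  => [||a b /=].
- exact: linear_tmap.
- by apply: linear_comp (tlift_mul_linear _) _; apply: linear_tmap.
- by rewrite !tmapE // tlift_mulE mul_pure mulr1 mul1r.
Qed.

Lemma invertible_pair_comul :
  invertible_pair (tmap gen gen \o comul) (conv inr_inv inl_inv).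
Proof.
have [[l1 _ _] l1' i1] := invertible_pair_inl.
have [[l2 _ _] l2' i2] := invertible_pair_inr.
split.
- exact: (poisson_comp (poisson_tmap pu pu) (@comul_poisson _ B)).
- exact: conv_linear.
- by rewrite tmap_gen_comul; apply: conv_inverse_conv.
Qed.

Definition hcomul : G -> G ⊗ G :=
  hlift (tmap gen gen \o comul) (conv inr_inv inl_inv).
Definition hcounit : G -> k^o := hlift counit counit.

Lemma hcomul_poisson : poisson_morphism hcomul.
Proof. exact: poisson_lift invertible_pair_comul. Qed.
Lemma hcounit_poisson : poisson_morphism hcounit.
Proof. exact: poisson_lift (invertible_pair_counit B). Qed.
Lemma hcomul_linear : linear hcomul. Proof. by case: hcomul_poisson. Qed.
Lemma hcounit_linear : linear hcounit. Proof. by case: hcounit_poisson. Qed.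

Lemma hcomul_gen : hcomul \o gen = tmap gen gen \o comul.
Proof. exact: lift_gen invertible_pair_comul. Qed.

(** In Sweedler notation [inv_gen b] goes to the sum of inv_gen b_2 ⊗ inv_gen b_1, the formula an
    antipode satisfies. *)
Lemma hcomul_inv_gen : hcomul \o inv_gen = conv inr_inv inl_inv.
Proof. exact: lift_inv_gen invertible_pair_comul. Qed.

Lemma hcounit_gen : hcounit \o gen = counit.
Proof. exact: lift_gen (invertible_pair_counit B). Qed.

Lemma hcounit_inv_gen : hcounit \o inv_gen = counit.
Proof. exact: lift_inv_gen (invertible_pair_counit B). Qed.

HB.instance Definition _ :=
  GRing.isLinear.Build k G (tensor G G) *:%R hcomul hcomul_linear.
HB.instance Definition _ :=
  GRing.isLinear.Build k G k^o *:%R hcounit hcounit_linear.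

(** Both sides are Poisson maps out of G(B), so [free_hopf_ext] reduces the claim to [gen], where it
    is coassociativity of [B]. The counit laws are proved alike. *)
Lemma hcomulA (x : G) :
  tassoc (tmap hcomul idfun (hcomul x)) = tmap idfun hcomul (hcomul x).
Proof.
have pid := @poisson_id k G; have lD := hcomul_linear.
apply: (@free_hopf_ext _ _ _ (@tassoc k G G G \o (tmap hcomul idfun \o hcomul))
  (tmap idfun hcomul \o hcomul)).
- apply: poisson_comp (poisson_tassoc _ _ _) _.
  apply: poisson_comp hcomul_poisson.
  by apply: poisson_tmap => //; exact: hcomul_poisson.
- apply: poisson_comp hcomul_poisson.
  by apply: poisson_tmap => //; exact: hcomul_poisson.
apply: funext => b /=.
rewrite -![hcomul (gen b)]/((hcomul \o gen) b).
rewrite hcomul_gen /= !tmap_comp // hcomul_gen.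
have lt : linear (tmap (@gen k B) (@gen k B)) by exact: linear_tmap.
have lc : linear (comul : B -> (B ⊗ B)%type) by exact: comul_linear.
(* Moving [idfun] inside lets [gen] be pulled out of all tensor slots, which exposes the
   coassociativity of [B]. *)
rewrite -[LHS]/(tassoc (tmap (tmap gen gen \o comul) (gen \o idfun) (comul b))).
rewrite -tmap_comp // tassoc_tmap // comulA.
by rewrite tmap_comp.
Qed.

Lemma hcounitl (x : G) : tmap hcounit idfun (hcomul x) = (1 : k^o) ⊗ x.
Proof.
have pid := @poisson_id k G; have lD := hcounit_linear.
apply: (@free_hopf_ext _ _ _ (tmap hcounit idfun \o hcomul)
  (fun x => (1 : k^o) ⊗ x)).
- apply: poisson_comp hcomul_poisson.
  by apply: poisson_tmap => //; exact: hcounit_poisson.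
- exact: poisson_pure1r.
apply: funext => b /=.
rewrite -[hcomul _]/((hcomul \o gen) b) hcomul_gen /= tmap_comp // hcounit_gen.
have lc : linear (counit : B -> k^o) by exact: counit_linear.
rewrite -[LHS]/(tmap (idfun \o counit) (gen \o idfun) (comul b)).
by rewrite -tmap_comp // counitl tmapE.
Qed.

Lemma hcounitr (x : G) : tmap idfun hcounit (hcomul x) = x ⊗ (1 : k^o).
Proof.
have pid := @poisson_id k G; have lD := hcounit_linear.
apply: (@free_hopf_ext _ _ _ (tmap idfun hcounit \o hcomul)
  (fun x => x ⊗ (1 : k^o))).
- apply: poisson_comp hcomul_poisson.
  by apply: poisson_tmap => //; exact: hcounit_poisson.
- exact: poisson_pure1l.
apply: funext => b /=.
rewrite -[hcomul _]/((hcomul \o gen) b) hcomul_gen /= tmap_comp // hcounit_gen.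
have lc : linear (counit : B -> k^o) by exact: counit_linear.
rewrite -[LHS]/(tmap (gen \o idfun) (idfun \o counit) (comul b)).
by rewrite -tmap_comp // counitr tmapE.
Qed.

HB.instance Definition _ :=
  isCoalgebra.Build k (free_hopf B) hcomulA hcounitl hcounitr.
HB.instance Definition _ :=
  isPoissonBialgebra.Build k (free_hopf B) hcomul_poisson hcounit_poisson.

(** * The antipode of G(B) *)

Definition hanti : G -> G := hlift (A := opp_bracket_alg G) inv_gen gen.

Lemma hanti_poisson : poisson_morphism (hanti : G -> opp_bracket_alg G).
Proof. exact: poisson_lift (invertible_pair_opp (invertible_pair_gen B)). Qed.

Lemma hanti_linear : linear hanti.
Proof. by case: hanti_poisson. Qed.
Lemma hanti_monoid_morphism : monoid_morphism hanti.
Proof. by case: hanti_poisson. Qed.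
Lemma hanti_bracket : {morph hanti : x y / ⟦ x, y ⟧ >-> - ⟦ x, y ⟧}.
Proof. by case: hanti_poisson. Qed.

Lemma hanti_gen : hanti \o gen = inv_gen.
Proof. exact: (lift_gen (invertible_pair_opp (invertible_pair_gen B))). Qed.
Lemma hanti_inv_gen : hanti \o inv_gen = gen.
Proof. exact: (lift_inv_gen (invertible_pair_opp (invertible_pair_gen B))). Qed.

(** The square reverses the bracket twice, so it is a Poisson map, and it fixes [gen]. *)
Lemma hantiK : involutive hanti.
Proof.
have [[h1 hM] hB] := (hanti_monoid_morphism, hanti_bracket).
apply: (@free_hopf_ext _ _ _ (hanti \o hanti) idfun) => //.
  split; first exact: linear_comp hanti_linear hanti_linear.
    by split=> [|x y] /=; rewrite ?h1 ?hM.
  move=> x y /=.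
  by rewrite hB -scaleN1r (linearZ_ hanti_linear) hB scaleN1r opprK.
by rewrite -compA hanti_gen hanti_inv_gen.
Qed.

(** Sends x ⊗ y to x S(y). It is multiplicative because [G] is commutative, hence compatible with
    convolution. *)
Let antipode_pairing : G ⊗ G -> G := tlift *%R \o tmap idfun hanti.

Let antipode_pairing_linear : linear antipode_pairing.
Proof.
apply: linear_comp (tlift_mul_linear G) _.
by apply: linear_tmap => //; exact: hanti_linear.
Qed.

Let antipode_pairingE x y : antipode_pairing (x ⊗ y) = x * hanti y.
Proof.
by rewrite /antipode_pairing /= tmapE ?tlift_mulE //; exact: hanti_linear.
Qed.

Let antipode_pairingM : {morph antipode_pairing : X Y / X * Y}.
Proof.
have lM := antipode_pairing_linear.
apply: bilin_tensor_ext => [||a b c d].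
- exact: linear_bilin lM (mul_bilin _).
- exact: (bilin_comp (mul_bilin _) lM lM).
- by rewrite mul_pure !antipode_pairingE (hanti_monoid_morphism).2; ring.
Qed.

(** Induction on the generated algebra: generators reduce to the inverse relation of [gen] and
    [inv_gen], while products and brackets are the closure lemmas for multiplicative,
    bracket-reversing maps. *)
Lemma conv_id_hanti : conv idfun hanti =1 conv1 G.
Proof.
have [_ _ [jP _]] := invertible_pair_gen B.
have [[l1 _ _] l1' _] := invertible_pair_inl.
have [[l2 _ _] l2' _] := invertible_pair_inr.
have [h1 hM] := hanti_monoid_morphism.
have M1 : antipode_pairing \o inl_gen = gen.
  by apply: funext => b /=; rewrite antipode_pairingE h1 mulr1.
have M2 : antipode_pairing \o inr_gen = inv_gen.
  by apply: funext => b /=; rewrite antipode_pairingE mul1r -hanti_gen.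
have M3 : antipode_pairing \o inl_inv = inv_gen.
  by apply: funext => b /=; rewrite antipode_pairingE h1 mulr1.
have M4 : antipode_pairing \o inr_inv = gen.
  by apply: funext => b /=; rewrite antipode_pairingE mul1r -hanti_inv_gen.
have lM := antipode_pairing_linear.
have pid := @poisson_id k G; have lid := @linear_id k G.
elim/free_hopf_ind => [b|b||x y ex ey|x y ex ey|a x ex|x y ex ey].
- rewrite -[LHS]/(antipode_pairing ((hcomul \o gen) b)) hcomul_gen.
  rewrite tmap_gen_comul conv_morph // M1 M2 jP /conv1.
  by rewrite -[counit (gen b)]/((hcounit \o gen) b) hcounit_gen.
- rewrite -[LHS]/(antipode_pairing ((hcomul \o inv_gen) b)) hcomul_inv_gen.
  (* The reversed order of [inr_inv] and [inl_inv] yields [gen] before [inv_gen], so [jP] applies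
     again. *)
  rewrite conv_morph // M3 M4 jP /conv1.
  by rewrite -[counit (inv_gen b)]/((hcounit \o inv_gen) b) hcounit_inv_gen.
- rewrite /conv comul1 tmapE //; last exact: hanti_linear.
  by rewrite tlift_mulE h1 mulr1 /conv1 counit1 scale1r.
- rewrite (linearD_ (conv_linear lid hanti_linear)) ex ey.
  by rewrite (linearD_ (conv1_linear _)).
- exact: conv_counitM pid hanti_linear _ _ hM ex ey.
- rewrite (linearZ_ (conv_linear lid hanti_linear)) ex.
  by rewrite (linearZ_ (conv1_linear _)).
- exact: conv_counit_bracket pid hanti_linear _ _ hM hanti_bracket ex ey.
Qed.

(** Apply S to the previous identity: S(x_1 S(x_2)) = S(x_1) x_2, as S is multiplicative and
    involutive. *)
Lemma conv_hanti_id : conv hanti idfun =1 conv1 G.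
Proof.
move=> x; have [h1 hM] := hanti_monoid_morphism; have lS := hanti_linear.
have e : hanti \o hanti = idfun by apply: funext => y; exact: hantiK.
rewrite -e -[X in conv X]/(hanti \o idfun) -conv_morph // conv_id_hanti.
by rewrite /conv1 (linearZ_ lS) h1.
Qed.

HB.instance Definition _ :=
  GRing.isLinear.Build k G G *:%R hanti hanti_linear.

Lemma hanti_antipode :
  exists S : {linear free_hopf B -> free_hopf B}, is_antipode S.
Proof.
by exists hanti => x; split; [exact: conv_hanti_id|exact: conv_id_hanti].
Qed.

HB.instance Definition _ := hasAntipode.Build k (free_hopf B) hanti_antipode.

End FreePoissonHopfStructure.

(** * The universal property of G(B) *)

Section UniversalProperty.
Variable k : fieldType.

Lemma gen_bialg_morphism (B : poissonBialgType k) :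
  poisson_bialg_morphism (@gen k B).
Proof.
have [pg _ _] := invertible_pair_gen B.
split=> //; split=> [|b|b]; first by case: pg.
- exact: (congr1 (fun h => h b) (hcomul_gen B)).
- exact: (congr1 (fun h => h b) (hcounit_gen B)).
Qed.

Lemma free_hopf_existence (B : poissonBialgType k) (H : poissonHopfType k)
    (f : B -> H) : poisson_bialg_morphism f ->
  exists2 g : free_hopf B -> H, poisson_bialg_morphism g & g \o gen = f.
Proof.
move=> [pf [lf fD fe]]; have [S SP] := @antipode_exists k H.
have lS : linear S by exact: linearP.
have uv : invertible_pair f (S \o f).
  have lid := @linear_id k H; split=> //; first exact: linear_comp.
  (* Because [f] respects comultiplication and counit, these are the antipode identities of [H] at
     [f x]. *)
  split=> x; rewrite /conv1 -fe.
  - rewrite -(SP (f x)).2 fD tmap_comp //.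
  - by rewrite -(SP (f x)).1 fD tmap_comp.
have pg := poisson_lift uv; have [lg _ _] := pg.
have gf := lift_gen uv.
exists (hlift f (S \o f)) => //; split=> //; split=> // x.
- have pgg := poisson_tmap pg pg.
  (* Compatibility with the comultiplication, and then with the counit, compares two Poisson maps
     out of G(B), so [gen] suffices. *)
  apply: (@free_hopf_ext _ _ _ (comul \o hlift f (S \o f))
    (tmap (hlift f (S \o f)) (hlift f (S \o f)) \o comul)).
  + exact: (poisson_comp (@comul_poisson _ H) pg).
  + exact: (poisson_comp pgg (@comul_poisson _ _)).
  have [_ [lgen genD _]] := gen_bialg_morphism B.
  apply: funext => b /=; rewrite genD tmap_comp // gf -fD.
  by rewrite -[hlift _ _ _]/((hlift f (S \o f) \o gen) b) gf.
- apply: (@free_hopf_ext _ _ _ (counit \o hlift f (S \o f)) counit).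
  + exact: (poisson_comp (@counit_poisson _ H) pg).
  + exact: counit_poisson.
  have [_ [_ _ gene]] := gen_bialg_morphism B.
  apply: funext => b /=; rewrite gene -fe.
  by rewrite -[hlift _ _ _]/((hlift f (S \o f) \o gen) b) gf.
Qed.

Lemma free_hopf_unique (B : poissonBialgType k) (H : poissonHopfType k)
    (g g' : free_hopf B -> H) :
  poisson_bialg_morphism g -> poisson_bialg_morphism g' ->
  g \o gen = g' \o gen -> g = g'.
Proof. by move=> [pg _] [pg' _] e; apply/funext/free_hopf_ext. Qed.

Lemma free_hopf_is_free (B : poissonBialgType k) :
  is_free_poisson_hopf (@gen k B).
Proof.
split=> [|H f pf]; first exact: gen_bialg_morphism.
have [g pg gf] := free_hopf_existence pf.
exists g; split=> // g' [pg' gf'].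
by apply: free_hopf_unique => //; rewrite gf gf'.
Qed.

(** * The free functor and the adjunction *)

Definition gen_hom (B : poissonBialgType k) :
    poisson_bialg_hom B (free_hopf B) :=
  exist _ _ (gen_bialg_morphism B).

(** Choice turns the existence statement into data, from which [extend_hom] is defined. *)
Lemma free_hom_existsT (B : poissonBialgType k) (H : poissonHopfType k)
    (f : poisson_bialg_hom B H) :
  {g : poisson_bialg_hom (free_hopf B) H |
    poisson_bialg_compm g (gen_hom B) = f}.
Proof.
apply: cid; case: f => f pf; have [g pg gf] := free_hopf_existence pf.
by exists (exist _ g pg); apply: poisson_bialg_hom_eq.
Qed.

Definition extend_hom (B : poissonBialgType k) (H : poissonHopfType k)
    (f : poisson_bialg_hom B H) : poisson_bialg_hom (free_hopf B) H :=
  sval (free_hom_existsT f).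

Lemma extend_homK (B : poissonBialgType k) (H : poissonHopfType k)
    (f : poisson_bialg_hom B H) :
  poisson_bialg_compm (extend_hom f) (gen_hom B) = f.
Proof. exact: svalP (free_hom_existsT f). Qed.

Lemma gen_hom_epi (B : poissonBialgType k) (H : poissonHopfType k)
    (g g' : poisson_bialg_hom (free_hopf B) H) :
  poisson_bialg_compm g (gen_hom B) = poisson_bialg_compm g' (gen_hom B) ->
  g = g'.
Proof.
move=> /(congr1 sval) e; apply: poisson_bialg_hom_eq.
exact: free_hopf_unique (svalP g) (svalP g') e.
Qed.

Definition free_fmap (B C : poissonBialgType k) (f : poisson_bialg_hom B C) :
    poisson_bialg_hom (free_hopf B) (free_hopf C) :=
  extend_hom (poisson_bialg_compm (gen_hom C) f).

Lemma free_fmapE (B C : poissonBialgType k) (f : poisson_bialg_hom B C) :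
  poisson_bialg_compm (free_fmap f) (gen_hom B) =
  poisson_bialg_compm (gen_hom C) f.
Proof. exact: extend_homK. Qed.

Lemma free_fmap1 (B : poissonBialgType k) :
  free_fmap (poisson_bialg_idm B) = poisson_bialg_idm (free_hopf B).
Proof.
apply: gen_hom_epi.
by rewrite free_fmapE poisson_bialg_comp1m poisson_bialg_compm1.
Qed.

Lemma free_fmapM (B C D : poissonBialgType k) (g : poisson_bialg_hom C D)
    (f : poisson_bialg_hom B C) :
  free_fmap (poisson_bialg_compm g f) =
  poisson_bialg_compm (free_fmap g) (free_fmap f).
Proof.
apply: gen_hom_epi; rewrite free_fmapE -poisson_bialg_compmA free_fmapE.
by rewrite !poisson_bialg_compmA free_fmapE.
Qed.

Definition free_functor : functor (poissonBialg_cat k) (poissonHopf_cat k) :=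
  @Functor (poissonBialg_cat k) (poissonHopf_cat k)
    (fun B => free_hopf B : poissonHopfType k)
    free_fmap free_fmap1 free_fmapM.

Lemma free_functor_left_adjoint :
  left_adjoint_of free_functor (forget_antipode k).
Proof.
(* The adjunction bijection is restriction along [gen]; its inverse is [extend_hom]. *)
exists (fun (B : poissonBialgType k) (H : poissonHopfType k)
  (g : poisson_bialg_hom (free_hopf B) H) => poisson_bialg_compm g (gen_hom B)).
split=> [B H|B B' H u h|B H H' v h] /=.
- exists (@extend_hom B H) => [g|f]; last exact: extend_homK.
  by apply: gen_hom_epi; rewrite extend_homK.
- by rewrite -!poisson_bialg_compmA free_fmapE.
- by rewrite poisson_bialg_compmA.
Qed.

End UniversalProperty.

Theorem theorem3p2 (k : fieldType) :
  (exists L : functor (poissonBialg_cat k) (poissonHopf_cat k),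
     left_adjoint_of L (forget_antipode k)) /\
  (forall B : poissonBialgType k,
     exists (G : poissonHopfType k) (i : B -> G), is_free_poisson_hopf i).
Proof.
split; first by exists (free_functor k); exact: free_functor_left_adjoint.
by move=> B; exists (free_hopf B), gen; exact: free_hopf_is_free.
Qed.
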